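(* Let $K$ be a field, let $\mathbb{X}\subseteq\mathbb{P}^n_K$ be a $0$-dimensional locally Gorenstein Cayley-Bacharach scheme with no point of $\mathrm{Supp}(\mathbb{X})$ on the hyperplane $X_0=0$, and let $\sigma$ be a homogeneous trace map of degree zero of $Q^h(R)/L_0$. Then the Hilbert function of $\delta^\sigma_{\mathbb{X}}$ satisfies $\mathrm{HF}_{\delta^\sigma_{\mathbb{X}}}(i)=0$ for $i<r_{\mathbb{X}}$, $\mathrm{HF}_{\delta^\sigma_{\mathbb{X}}}(i)=\deg(\mathbb{X})$ for $i\ge2r_{\mathbb{X}}$, and $$0\le\mathrm{HF}_{\delta^\sigma_{\mathbb{X}}}(r_{\mathbb{X}})\le\cdots\le\mathrm{HF}_{\delta^\sigma_{\mathbb{X}}}(2r_{\mathbb{X}}-1)<\mathrm{HF}_{\delta^\sigma_{\mathbb{X}}}(2r_{\mathbb{X}})=\deg(\mathbb{X}).$$ In this case, the regularity index of $\delta^\sigma_{\mathbb{X}}$ is exactly $2r_{\mathbb{X}}$.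
   Context: Setting. $P=K[X_0,\dots,X_n]$ has the standard grading, $I_{\mathbb{X}}\subseteq P$ is the (saturated) homogeneous vanishing ideal of $\mathbb{X}$, $R=P/I_{\mathbb{X}}$, and $\mathrm{Supp}(\mathbb{X})=\{p_1,\dots,p_s\}$ is the set of closed points. The residue class $x_0$ of $X_0$ in $R$ is a non-zerodivisor. $\mathcal{O}_{\mathbb{X},p_j}$ is the local ring at $p_j$, with residue field $\kappa(p_j)$; $\varkappa_j=\dim_K\kappa(p_j)$; $\deg(\mathbb{X})=\sum_j\dim_K\mathcal{O}_{\mathbb{X},p_j}$. For a finitely generated graded $R$-module $M$, $\mathrm{HF}_M(i)=\dim_KM_i$, $\mathrm{HP}_M$ is its Hilbert polynomial, and its regularity index is $\mathrm{ri}(M)=\min\{i\in\mathbb{Z}\mid\mathrm{HF}_M(j)=\mathrm{HP}_M(j)\text{ for all }j\ge i\}$. $\mathrm{HF}_{\mathbb{X}}=\mathrm{HF}_R$ and $r_{\mathbb{X}}=\mathrm{ri}(R)$, i.e. the least integer with $\mathrm{HF}_{\mathbb{X}}(i)=\deg(\mathbb{X})$ for all $i\ge r_{\mathbb{X}}$. $\mathbb{X}$ is locally Gorenstein if every $\mathcal{O}_{\mathbb{X},p_j}$ is a Gorenstein ring. $Q^h(R)$ is the localization of $R$ at all homogeneous non-zerodivisors; $Q^h(R)=R_{x_0}\cong\prod_{j=1}^s\mathcal{O}_{\mathbb{X},p_j}[T_j,T_j^{-1}]$ with $\deg T_j=1$, via the injection $\tilde\imath:R\to Q^h(R)$, $\tilde\imath(f)=(f_{p_1}T_1^i,\dots,f_{p_s}T_s^i)$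 for $f\in R_i$, where $f_{p_j}$ is the germ of $f$ at $p_j$ (the image of $f/x_0^i$ in $\mathcal{O}_{\mathbb{X},p_j}$). Cayley-Bacharach. A subscheme $\mathbb{Y}\subseteq\mathbb{X}$ is a $p_j$-subscheme if $\mathcal{O}_{\mathbb{Y},p_k}=\mathcal{O}_{\mathbb{X},p_k}$ for $k\ne j$ and $\mathcal{O}_{\mathbb{X},p_j}\to\mathcal{O}_{\mathbb{Y},p_j}$ is surjective; it is maximal if $\deg(\mathbb{Y})=\deg(\mathbb{X})-\varkappa_j$. Maximal $p_j$-subschemes correspond bijectively to the ideals $\langle s_j\rangle$ of $\mathcal{O}_{\mathbb{X},p_j}$ generated by a nonzero socle element $s_j$ (with $\mathcal{O}_{\mathbb{Y},p_j}=\mathcal{O}_{\mathbb{X},p_j}/\langle s_j\rangle$). For $a\in\mathcal{O}_{\mathbb{X},p_j}$ put $\mu(a)=\min\{i\in\mathbb{N}\mid(0,\dots,0,aT_j^i,0,\dots,0)\in\tilde\imath(R)\}$ (entry in position $j$). If $e_{j1},\dots,e_{j\varkappa_j}\in\mathcal{O}_{\mathbb{X},p_j}$ have residue classes forming a $K$-basis of $\kappa(p_j)$, put $\mu_{\mathbb{Y}/\mathbb{X}}=\max_k\mu(e_{jk}s_j)$ (independent of the choices). $\deg_{\mathbb{X}}(p_j)$ is the minimum of $\mu_{\mathbb{Y}/\mathbb{X}}$ over all maximal $p_j$-subschemes $\mathbb{Y}$; one has $\deg_{\mathbb{X}}(p_j)\le r_{\mathbb{X}}$. $\mathbb{X}$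 is a Cayley-Bacharach scheme if $\deg_{\mathbb{X}}(p_j)=r_{\mathbb{X}}$ for all $j$. Dedekind different. $L_0=K[x_0,x_0^{-1}]$. A homogeneous trace map of degree zero of $Q^h(R)/L_0$ is a homogeneous element $\sigma$ of degree $0$ of the graded module $\underline{\mathrm{Hom}}_{L_0}(Q^h(R),L_0)$ which is a $Q^h(R)$-basis of it; it exists when $\mathbb{X}$ is locally Gorenstein. The Dedekind complementary module $\mathfrak{C}^\sigma_{\mathbb{X}}\subseteq Q^h(R)$ is the image of the injection $\underline{\mathrm{Hom}}_{K[x_0]}(R,K[x_0])\to\underline{\mathrm{Hom}}_{L_0}(Q^h(R),L_0)=Q^h(R)\sigma\cong Q^h(R)$, $\varphi\mapsto\varphi\otimes\mathrm{id}_{L_0}$ (the last isomorphism sending $g\sigma$ to $g$). The Dedekind different is $\delta^\sigma_{\mathbb{X}}=\{f\in Q^h(R)\mid f\cdot\mathfrak{C}^\sigma_{\mathbb{X}}\subseteq R\}$, a homogeneous ideal of $R$. *)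

(* Defs.v *)
From HB Require Import structures.
From mathcomp Require Import all_boot all_order all_algebra.
From mathcomp Require Import generic_quotient ring_quotient ring.
From mathcomp Require Import mpoly.
From mathcomp Require Import boolp classical_sets.

Set Implicit Arguments.
Unset Strict Implicit.
Unset Printing Implicit Defensive.

Import Order.TTheory GRing.Theory Num.Theory.
Local Open Scope quotient_scope.
Local Open Scope classical_set_scope.
Local Open Scope ring_scope.

(* Localization S^-1 R of a commutative ring at a multiplicative subset; it is
   the zero ring when 0 \in S, whence the comPzRingType structure. *)
Section Localization.
Variables (R : comNzRingType) (S : mulrClosed R).

Definition den := {s : R | s \in S}.
Definition den1 : den := exist _ 1 (rpred1 _).
Definition denM (s t : den) : den :=
  exist _ (val s * val t) (rpredM (valP s) (valP t)).

Definition loc_equiv (u v : R * den) : bool :=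
  `[< exists2 w, w \in S & w * (u.1 * val v.2 - v.1 * val u.2) = 0 >].

Lemma loc_equiv_is_equiv : equiv_class_of loc_equiv.
Proof.
have sym u v : loc_equiv u v -> loc_equiv v u.
  move=> /asboolP[w wS e]; apply/asboolP; exists w => //.
  by rewrite -opprB mulrN e oppr0.
split=> [u|u v|v u w].
- by apply/asboolP; exists 1; rewrite ?rpred1 // subrr mulr0.
- by apply/idP/idP; apply: sym.
move=> /asboolP[a aS ea] /asboolP[b bS eb]; apply/asboolP.
exists (a * b * val v.2); first by rewrite !rpredM ?(valP v.2).
have -> : a * b * val v.2 * (u.1 * val w.2 - w.1 * val u.2) =
          b * val w.2 * (a * (u.1 * val v.2 - v.1 * val u.2)) +
          a * val u.2 * (b * (v.1 * val w.2 - w.1 * val v.2)) by ring.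
by rewrite ea eb !mulr0 addr0.
Qed.

Canonical loc_equiv_equiv := EquivRelPack loc_equiv_is_equiv.
Canonical loc_equiv_encModRel := defaultEncModRel loc_equiv.

Definition loc := {eq_quot loc_equiv}.

HB.instance Definition _ : EqQuotient (R * den)%type loc_equiv loc :=
  EqQuotient.on loc.
HB.instance Definition _ := Choice.on loc.

Lemma loc_eqP (u v : R * den) :
  (\pi_loc u = \pi_loc v) <->
  exists2 w, w \in S & w * (u.1 * val v.2 - v.1 * val u.2) = 0.
Proof.
split=> [/eqP|h]; first by rewrite piE => /asboolP.
by apply/eqP; rewrite piE; apply/asboolP.
Qed.

Let add2 (u v : R * den) : R * den :=
  (u.1 * val v.2 + v.1 * val u.2, denM u.2 v.2).
Let mul2 (u v : R * den) : R * den := (u.1 * v.1, denM u.2 v.2).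
Let opp2 (u : R * den) : R * den := (- u.1, u.2).

Definition loc_zero : loc := \pi_loc (0, den1).
Definition loc_one : loc := \pi_loc (1, den1).
Definition loc_opp (x : loc) : loc := \pi_loc (opp2 (repr x)).
Definition loc_add (x y : loc) : loc := \pi_loc (add2 (repr x) (repr y)).
Definition loc_mul (x y : loc) : loc := \pi_loc (mul2 (repr x) (repr y)).

Let reprP (u : R * den) : exists2 w, w \in S &
  w * ((repr (\pi_loc u)).1 * val u.2 - u.1 * val (repr (\pi_loc u)).2) = 0.
Proof. by apply/loc_eqP; rewrite reprK. Qed.

Let oppE u : loc_opp (\pi_loc u) = \pi_loc (opp2 u).
Proof.
apply/loc_eqP => /=; have [w wS e] := reprP u; exists w => //.
move: (repr _) e => v /= e.
by rewrite -[RHS]oppr0 -e; ring.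
Qed.

Let addE u v : loc_add (\pi_loc u) (\pi_loc v) = \pi_loc (add2 u v).
Proof.
apply/loc_eqP => /=; have [a aS ea] := reprP u; have [b bS eb] := reprP v.
exists (a * b); first by rewrite rpredM.
move: (repr _) (repr _) ea eb => v' u' /= ea eb.
transitivity (b * sval v.2 * sval v'.2 *
    (a * (u'.1 * sval u.2 - u.1 * sval u'.2)) +
  a * sval u.2 * sval u'.2 * (b * (v'.1 * sval v.2 - v.1 * sval v'.2))).
  by ring.
by rewrite ea eb !mulr0 addr0.
Qed.

Let mulE u v : loc_mul (\pi_loc u) (\pi_loc v) = \pi_loc (mul2 u v).
Proof.
apply/loc_eqP => /=; have [a aS ea] := reprP u; have [b bS eb] := reprP v.
exists (a * b); first by rewrite rpredM.
move: (repr _) (repr _) ea eb => v' u' /= ea eb.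
transitivity (b * v'.1 * sval v.2 *
    (a * (u'.1 * sval u.2 - u.1 * sval u'.2)) +
  a * u.1 * sval u'.2 * (b * (v'.1 * sval v.2 - v.1 * sval v'.2))).
  by ring.
by rewrite ea eb !mulr0 addr0.
Qed.

Let pi_eq (u v : R * den) : u.1 * val v.2 = v.1 * val u.2 ->
  \pi_loc u = \pi_loc v.
Proof.
by move=> e; apply/loc_eqP; exists 1; rewrite ?rpred1 // e subrr mulr0.
Qed.

Let pi_surj (x : loc) : exists u, x = \pi_loc u.
Proof. by exists (repr x); rewrite reprK. Qed.

Let loc_addA : associative loc_add.
Proof.
move=> x y z; have [[[u ->] [v ->]] [w ->]] := (pi_surj x, pi_surj y, pi_surj z).
rewrite (addE v w) (addE u v) (addE u (add2 v w)) (addE (add2 u v) w).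
by apply: pi_eq => /=; ring.
Qed.

Let loc_addC : commutative loc_add.
Proof.
move=> x y; have [[u ->] [v ->]] := (pi_surj x, pi_surj y).
by rewrite (addE u v) (addE v u); apply: pi_eq => /=; ring.
Qed.

Let loc_add0 : left_id loc_zero loc_add.
Proof.
move=> x; have [u ->] := pi_surj x.
by rewrite (addE (0, den1) u); apply: pi_eq => /=; ring.
Qed.

Let loc_addN : left_inverse loc_zero loc_opp loc_add.
Proof.
move=> x; have [u ->] := pi_surj x.
by rewrite (oppE u) (addE (opp2 u) u); apply: pi_eq => /=; ring.
Qed.

HB.instance Definition _ :=
  GRing.isZmodule.Build loc loc_addA loc_addC loc_add0 loc_addN.

Let loc_mulA : associative loc_mul.
Proof.
move=> x y z; have [[[u ->] [v ->]] [w ->]] := (pi_surj x, pi_surj y, pi_surj z).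
rewrite (mulE v w) (mulE u v) (mulE u (mul2 v w)) (mulE (mul2 u v) w).
by apply: pi_eq => /=; ring.
Qed.

Let loc_mulC : commutative loc_mul.
Proof.
move=> x y; have [[u ->] [v ->]] := (pi_surj x, pi_surj y).
by rewrite (mulE u v) (mulE v u); apply: pi_eq => /=; ring.
Qed.

Let loc_mul1 : left_id loc_one loc_mul.
Proof.
move=> x; have [u ->] := pi_surj x.
by rewrite (mulE (1, den1) u); apply: pi_eq => /=; ring.
Qed.

Let loc_mulD : left_distributive loc_mul loc_add.
Proof.
move=> x y z; have [[[u ->] [v ->]] [w ->]] := (pi_surj x, pi_surj y, pi_surj z).
rewrite (addE u v) (mulE u w) (mulE v w) (mulE (add2 u v) w).
by rewrite (addE (mul2 u w) (mul2 v w)); apply: pi_eq => /=; ring.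
Qed.

HB.instance Definition _ :=
  GRing.Zmodule_isComPzRing.Build loc loc_mulA loc_mulC loc_mul1 loc_mulD.

(* The fraction r / s; only meaningful for s \in S (otherwise it is r / 1). *)
Definition frac (r s : R) : loc := \pi_loc (r, insubd den1 s).

Lemma frac_eqP r s r' s' : s \in S -> s' \in S ->
  frac r s = frac r' s' <-> exists2 w, w \in S & w * (r * s' - r' * s) = 0.
Proof. by move=> sS s'S; rewrite loc_eqP /= !insubdK. Qed.

Lemma frac_repr (x : loc) : exists r s, s \in S /\ x = frac r s.
Proof.
exists (repr x).1, (val (repr x).2); split; first exact: valP.
by rewrite /frac valKd -surjective_pairing reprK.
Qed.

Let insubdM s t : s \in S -> t \in S ->
  insubd den1 (s * t) = denM (insubd den1 s) (insubd den1 t).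
Proof. by move=> sS tS; apply: val_inj; rewrite /= !insubdK ?rpredM. Qed.

Lemma fracD r s r' s' : s \in S -> s' \in S ->
  frac r s + frac r' s' = frac (r * s' + r' * s) (s * s').
Proof.
move=> sS s'S; rewrite [LHS]addE /frac /add2 /=.
by rewrite !insubdK // insubdM.
Qed.

Lemma fracM r s r' s' : s \in S -> s' \in S ->
  frac r s * frac r' s' = frac (r * r') (s * s').
Proof. by move=> sS s'S; rewrite [LHS]mulE /frac /mul2 /= insubdM. Qed.

Lemma fracN r s : - frac r s = frac (- r) s.
Proof. by rewrite [LHS]oppE. Qed.

Let insubd_den1 : insubd den1 1 = den1.
Proof. by apply: val_inj; rewrite insubdK ?rpred1. Qed.

Lemma frac0 : frac 0 1 = 0.
Proof. by rewrite /frac insubd_den1. Qed.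

Lemma frac1 : frac 1 1 = 1.
Proof. by rewrite /frac insubd_den1. Qed.

Definition loc_deg (gr : int -> set R) (i : int) : set loc :=
  [set z | exists d e f g,
    [/\ gr d f, gr e g, g \in S, i = d - e & z = frac f g]].

End Localization.
Arguments frac {R} S r s.
Arguments loc_deg {R} S gr i _.

Section LinearAlgebra.
Variables (K : fieldType) (A : pzRingType) (k : K -> A).

(* e represents a basis of V / W, where A is a K-vector space via k *)
Definition basis_mod (V W : set A) (d : nat) (e : 'I_d -> A) : Prop :=
  [/\ forall i, V (e i),
      forall c : 'I_d -> K,
        W (\sum_i k (c i) * e i) -> forall i, c i = 0
    & forall v, V v -> exists c : 'I_d -> K, W (v - \sum_i k (c i) * e i)].

Definition has_dim (V W : set A) (d : nat) : Prop :=
  exists e : 'I_d -> A, basis_mod V W e.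

(* 0 by convention if V / W is not finite dimensional *)
Definition dimK (V W : set A) : nat := xget 0%N (has_dim V W).

Definition HF (gr : int -> set A) (M : set A) (i : int) : nat :=
  dimK (M `&` gr i) [set 0].

End LinearAlgebra.

Definition hilbert_poly (H : int -> nat) (p : {poly rat}) : Prop :=
  exists N : int, forall j : int, N <= j -> (H j)%:R = p.[j%:~R].

Definition is_ri (H : int -> nat) (r : int) : Prop :=
  exists2 p : {poly rat}, hilbert_poly H p &
    (forall j : int, r <= j -> (H j)%:R = p.[j%:~R]) /\
    (forall i : int, (forall j : int, i <= j -> (H j)%:R = p.[j%:~R]) ->
       r <= i).

Definition ri (H : int -> nat) : int := xget 0 (is_ri H).

(* min N, and 0 by convention if N is empty *)
Definition nmin (N : set nat) : nat :=
  xget 0%N [set m | N m /\ forall i, N i -> (m <= i)%N].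

Section Gorenstein.
Variable A : comPzRingType.

Definition noetherian : Prop :=
  forall J : set A, J 0 ->
    (forall a x y, J x -> J y -> J (a * x + y)) ->
    exists m (g : 'I_m -> A), forall x,
      J x <-> exists c : 'I_m -> A, x = \sum_i c i * g i.

Definition inv_elt (a : A) : Prop := exists b, a * b = 1.

Definition local_ring : Prop :=
  1 <> 0 :> A /\ forall a b, inv_elt (a + b) -> inv_elt a \/ inv_elt b.

Definition injective_module (E : lmodType A) : Prop :=
  forall (M N : lmodType A) (i : {linear M -> N}) (f : {linear M -> E}),
    injective i -> exists h : {linear N -> E}, forall x, h (i x) = f x.

(* existence of an injective resolution 0 -> A -> E_0 -> ... -> E_d -> 0 *)
Definition finite_injdim : Prop :=
  exists (d : nat) (E : nat -> lmodType A)
    (eps : {linear A^o -> E 0%N}) (bd : forall i, {linear E i -> E i.+1}),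
    [/\ forall i, injective_module (E i),
        forall i, (d < i)%N -> forall x : E i, x = 0,
        injective eps,
        forall x : E 0%N, bd 0%N x = 0 <-> exists a, x = eps a
      & forall i (x : E i.+1), bd i.+1 x = 0 <-> exists y, x = bd i y].

Definition gorenstein_local : Prop :=
  [/\ local_ring, noetherian & finite_injdim].

End Gorenstein.

Section GradedHom.
Variables (A : pzRingType) (B : set A) (gr : int -> set A).

(* For a subring B of A, Hom_B(A, B) is encoded by the B-linear maps A -> A
   with values in B. *)
Definition lin_hom (phi : A -> A) : Prop :=
  [/\ forall x, B (phi x),
      forall x y, phi (x + y) = phi x + phi y
    & forall b x, B b -> phi (b * x) = b * phi x].

Definition hom_deg (d : int) (phi : A -> A) : Prop :=
  lin_hom phi /\ forall i x, gr i x -> gr (i + d) (phi x).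

Definition graded_hom (phi : A -> A) : Prop :=
  exists m (d : 'I_m -> int) (psi : 'I_m -> A -> A),
    (forall k, hom_deg (d k) (psi k)) /\ forall x, phi x = \sum_k psi k x.

End GradedHom.

Section Schemes.
Variables (K : fieldType) (n : nat).
Local Notation P := {mpoly K[n.+1]}.

Definition ideal (J : {pred P}) : Prop :=
  0 \in J /\ forall a f g, f \in J -> g \in J -> a * f + g \in J.

Definition homogeneous (J : {pred P}) : Prop :=
  forall f d, f \in J -> pihomog mdeg d f \in J.

Definition saturated (J : {pred P}) : Prop :=
  forall f, (exists N, forall h : P, h \is N.-homog for mdeg -> h * f \in J) ->
    f \in J.

(* A nonempty closed subscheme X of P^n_K is given by its proper saturated
   homogeneous ideal I. *)
Variable I : idealr P.

(* points of X = Proj (P / I) *)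
Definition point (p : prime_idealr P) : Prop :=
  [/\ homogeneous p, {subset I <= p} & exists i, 'X_i \notin p].

Definition zero_dimensional : Prop :=
  (exists p, point p) /\
  forall p q, point p -> point q -> {subset p <= q} -> p =i q.

(* pt enumerates the points of X, which are all closed if dim X = 0 *)
Definition enum_supp (s : nat) (pt : 'I_s -> prime_idealr P) : Prop :=
  [/\ forall j, point (pt j),
      forall j k, pt j =i pt k -> j = k
    & forall p, point p -> exists j, p =i pt j].

Definition coord_ring := {ideal_quot I}.
HB.instance Definition _ := GRing.ComNzRing.on coord_ring.
Local Notation R := coord_ring.

Definition cls (f : P) : R := \pi_({ideal_quot I}) f.
Definition kR (c : K) : R := cls c%:MP.
Definition x0 : R := cls 'X_ord0.

Definition grR (i : int) : set R :=
  if i is Posz d then [set x | exists2 f, f \is d.-homog for mdeg & x = cls f]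
  else [set 0].

Definition HFX : int -> nat := HF kR grR setT.
Definition rX : int := ri HFX.

Definition hnzd : {pred R} :=
  fun x => `[< (exists i, grR i x) /\ forall y, x * y = 0 -> y = 0 >].

Lemma cls1 : cls 1 = 1. Proof. by rewrite /cls rmorph1. Qed.
Lemma clsM f g : cls (f * g) = cls f * cls g.
Proof. by rewrite /cls rmorphM. Qed.
Lemma clsB f g : cls (f - g) = cls f - cls g.
Proof. by rewrite /cls rmorphB. Qed.
Lemma cls0 : cls 0 = 0. Proof. by rewrite /cls rmorph0. Qed.

Lemma grR1 : grR 0 1.
Proof. by exists 1; rewrite ?cls1 ?dhomog1. Qed.

Lemma grRM i j x y : grR i x -> grR j y -> grR (i + j) (x * y).
Proof.
have gr0 k : grR k 0.
  by case: k => d //; exists 0; rewrite ?cls0 // dhomog0.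
case: i => [d|d]; last by move=> ->; rewrite mul0r => _; exact: gr0.
case: j => [e|e]; last by move=> _ ->; rewrite mulr0; exact: gr0.
by move=> [f fd ->] [g ge ->]; exists (f * g); rewrite ?clsM ?dhomogM.
Qed.

Lemma grRB i x y : grR i x -> grR i y -> grR i (x - y).
Proof.
case: i => [d|d]; last by move=> -> ->; rewrite subr0.
by move=> [f fd ->] [g gd ->]; exists (f - g); rewrite ?clsB ?rpredB.
Qed.

Lemma hnzd_closed : mulr_closed hnzd.
Proof.
split.
  by apply/asboolP; split=> [|y]; [exists 0; exact: grR1|rewrite mul1r].
move=> x y /asboolP[[i ix] hx] /asboolP[[j jy] hy]; apply/asboolP; split.
  by exists (i + j); exact: grRM.
by move=> z; rewrite -mulrA => /hx /hy.
Qed.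
HB.instance Definition _ := GRing.isMulClosed.Build R hnzd hnzd_closed.

Definition Qh := loc hnzd.
HB.instance Definition _ := GRing.ComPzRing.on Qh.

Definition iota (x : R) : Qh := frac hnzd x 1.
Definition kQ (c : K) : Qh := iota (kR c).
Definition grQ : int -> set Qh := loc_deg hnzd grR.

(* K[x_0] in R, and L_0 = K[x_0, x_0^-1] in Q^h(R) *)
Definition Kx0 : set R :=
  [set x | exists q : {poly K}, x = (map_poly kR q).[x0]].
Definition L0 : set Qh :=
  [set z | exists (q : {poly K}) m,
     z = frac hnzd (map_poly kR q).[x0] (x0 ^+ m)].

(* sigma is homogeneous of degree 0 and a Q^h(R)-basis of the graded Hom, the
   module structure being (g sigma)(x) = sigma (g * x) *)
Definition trace_map (sigma : Qh -> Qh) : Prop :=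
  hom_deg L0 grQ 0 sigma /\
  forall phi, graded_hom L0 grQ phi ->
    exists! g, forall x, phi x = sigma (g * x).

(* g sigma = phi \otimes id_{L_0} on R \otimes_{K[x_0]} L_0 = Q^h(R) *)
Definition compl_module (sigma : Qh -> Qh) : set Qh :=
  [set g | exists2 phi : R -> R, graded_hom Kx0 grR phi &
     forall c f, L0 c -> sigma (g * (c * iota f)) = c * iota (phi f)].

Definition different (sigma : Qh -> Qh) : set Qh :=
  [set f | forall g, compl_module sigma g -> range iota (f * g)].

Section LocalRing.
Variable p : prime_idealr P.

Definition hcompl : {pred R} :=
  fun x => `[< exists d f, [/\ f \is d.-homog for mdeg, f \notin p & x = cls f] >].

Lemma hcompl_closed : mulr_closed hcompl.
Proof.
split.
  by apply/asboolP; exists 0%N, 1; rewrite dhomog1 idealr1 cls1.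
move=> x y /asboolP[d [f [fd fp ->]]] /asboolP[e [g [ge gp ->]]].
apply/asboolP; exists (d + e)%N, (f * g); split; last by rewrite clsM.
  exact: dhomogM.
by rewrite prime_idealrM negb_or fp.
Qed.
HB.instance Definition _ := GRing.isMulClosed.Build R hcompl hcompl_closed.

Definition locp := loc hcompl.
HB.instance Definition _ := GRing.ComPzRing.on locp.

Definition kL (c : K) : locp := frac hcompl (kR c) 1.

(* O_{X,p} is the degree 0 part of the homogeneous localization of R at p *)
Definition Op : set locp := loc_deg hcompl grR 0.

(* J O_{X,p} for a homogeneous ideal J of P *)
Definition ext (J : {pred P}) : set locp :=
  [set z | exists d f g, [/\ f \in J, grR d (cls f), grR d g, g \in hcompl
                           & z = frac hcompl (cls f) g]].

Definition max_ideal : set locp := ext p.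

(* dim_K of the residue field of O_{X,p} *)
Definition varkappa : nat := dimK kL Op max_ideal.

Definition OpP : {pred locp} := fun z => `[< Op z >].

Lemma OpP_closed : subring_closed OpP.
Proof.
split=> [|x y|x y].
- apply/asboolP; exists 0, 0, 1, 1; split => //; try exact: grR1.
    exact: rpred1.
  by rewrite frac1.
- move=> /asboolP[d [e [f [g [df eg gS de ->]]]]].
  move=> /asboolP[d' [e' [f' [g' [df' eg' gS' de' ->]]]]]; apply/asboolP.
  exists (e + e'), (e + e'), (f * g' - f' * g), (g * g').
  have dE : d = e by apply/eqP; rewrite -subr_eq0 -de.
  have dE' : d' = e' by apply/eqP; rewrite -subr_eq0 -de'.
  split; first 1 last; first exact: grRM.
  + exact: rpredM.
  + by rewrite subrr.
  + by rewrite fracN fracD // mulNr.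
  + apply: grRB; first by apply: grRM; rewrite -?dE.
    by rewrite addrC; apply: grRM; rewrite -?dE'.
- move=> /asboolP[d [e [f [g [df eg gS de ->]]]]].
  move=> /asboolP[d' [e' [f' [g' [df' eg' gS' de' ->]]]]]; apply/asboolP.
  exists (d + d'), (e + e'), (f * f'), (g * g'); split; try exact: grRM.
  + exact: rpredM.
  + by rewrite opprD addrACA -de -de' addr0.
  + by rewrite fracM.
Qed.
HB.instance Definition _ := GRing.isSubringClosed.Build locp OpP OpP_closed.

Definition local_ring_at := {z : locp | z \in OpP}.
HB.instance Definition _ := SubChoice.on local_ring_at.
HB.instance Definition _ :=
  GRing.SubChoice_isSubComPzRing.Build locp OpP local_ring_at OpP_closed.

End LocalRing.

Definition locally_gorenstein (s : nat) (pt : 'I_s -> prime_idealr P) : Prop :=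
  forall j, gorenstein_local (local_ring_at (pt j)).

Section CayleyBacharach.
Variables (s : nat) (pt : 'I_s -> prime_idealr P).

(* deg Y = \sum_k dim_K O_{Y,p_k} for the subscheme Y of X defined by J, where
   O_{Y,p_k} = O_{X,p_k} / J O_{X,p_k} *)
Definition deg_sub (J : {pred P}) : nat :=
  \sum_(k < s) dimK (@kL (pt k)) (@Op (pt k)) (@ext (pt k) J).

Definition degX : nat :=
  \sum_(k < s) dimK (@kL (pt k)) (@Op (pt k)) [set 0%R].

(* germ at p of f \in R_i *)
Definition germ (p : prime_idealr P) (i : nat) (f : R) : locp p :=
  frac (hcompl p) f (x0 ^+ i).

(* (0, .., 0, a T_j^i, 0, .., 0) is homogeneous of degree i, so it lies in the
   image of R iff it is the image of some f \in R_i *)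
Definition mu (j : 'I_s) (a : locp (pt j)) : nat :=
  nmin [set i : nat | exists f, [/\ grR i%:Z f, germ (pt j) i f = a
                            & forall k, k != j -> germ (pt k) i f = 0]].

Definition maximal_subscheme (j : 'I_s) (J : {pred P}) : Prop :=
  [/\ [/\ ideal J, homogeneous J & saturated J], {subset I <= J},
      forall k, k != j -> @ext (pt k) J `<=` [set 0]
    & (deg_sub J + varkappa (pt j))%N = degX].

(* m is the value of mu_{Y/X} for the maximal p_j-subscheme Y given by J,
   with O_{Y,p_j} = O_{X,p_j} / <a> for the socle element a *)
Definition is_mu_sub (j : 'I_s) (J : {pred P}) (m : nat) : Prop :=
  exists (a : locp (pt j)) (d : nat) (e : 'I_d -> locp (pt j)),
    [/\ [/\ Op a, a <> 0 & forall z, max_ideal z -> z * a = 0],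
        ext J = [set b * a | b in @Op (pt j)],
        basis_mod (@kL (pt j)) (@Op (pt j)) (@max_ideal (pt j)) e
      & m = (\max_(k < d) mu (e k * a)%R)%N].

Definition deg_point (j : 'I_s) : nat :=
  nmin [set m | exists2 J, maximal_subscheme j J & is_mu_sub j J m].

Definition cayley_bacharach : Prop := forall j, (deg_point j)%:Z = rX.

End CayleyBacharach.

Definition HFdiff (sigma : Qh -> Qh) : int -> nat :=
  HF kQ grQ (different sigma).

End Schemes.

(* Main.v *)
(* With A the degree 0 part of Q^h(R) (a K-algebra of dimension deg X) and
   F_i = x_0^-i R_i, an increasing filtration of A with F_i = A iff i >= r, the
   degree i part of the complementary module is x_0^i times the orthogonal of
   F_(-i-1) for the trace form on A.  The Cayley-Bacharach property says that
   F_(r-1) contains no nonzero ideal of A: a minimal such ideal is generated by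
   a socle element at some point p_j and would define a maximal p_j-subscheme
   of degree < r.  If x_0^i a lies in the different with i < r, then a kills the
   orthogonal of F_(r-1), so the ideal a A lies in F_(r-1) by biduality and
   a = 0.  If the different contained all of degree 2 r - 1, then the ideal
   generated by the orthogonal of F_(r-1) would lie in F_(r-1), although F_(r-1)
   is not all of A.  Since no point of X lies on X_0 = 0, every X_i is nilpotent
   modulo x_0, which makes R a finite module over K[x_0] without any appeal to
   dimension theory. *)

From HB Require Import structures.
Require Import Defs.
From mathcomp Require Import all_boot all_order all_algebra.
From mathcomp Require Import generic_quotient ring_quotient ring.
From mathcomp Require Import mpoly.
From mathcomp Require Import boolp classical_sets.

Set Implicit Arguments.
Unset Strict Implicit.
Unset Printing Implicit Defensive.

Import Order.TTheory GRing.Theory Num.Theory.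
Local Open Scope quotient_scope.
Local Open Scope classical_set_scope.
Local Open Scope ring_scope.

(** Orthogonality needs finite-dimensional spaces, while Q^h(R) inverts every homogeneous
    non-zerodivisor and has elements that are not homogeneous. Powers of x_0 remove both obstacles.
    Once R_(d+1) = x_0 R_d for large d, multiplication by a homogeneous non-zerodivisor is an
    injection between spaces of equal dimension, so every such element divides a power of x_0. Hence
    Q^h(R) is R localized at x_0, and x_0^i identifies its degree i piece with A. The decomposition
    of A into local rings is obtained by hand: Fitting's argument for the powers of a single element
    of A gives elements with germ 1 at one point and 0 at another, and products of these isolate
    each point. Biduality rests on nondegeneracy of the trace form, which is the uniqueness of the
    coefficient g in phi = g sigma, applied to phi = 0. *)

Lemma addr_idem0 (B : zmodType) (x : B) : x = x + x -> x = 0.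
Proof. by move=> e; rewrite -(subrr x) {2}e addrK. Qed.

(** * Linear algebra over classical sets *)

Section LinearSets.
Variables (K : fieldType) (A : pzRingType) (k : {rmorphism K -> A}).
Implicit Types V W U : set A.

Definition lincomb d (c : 'I_d -> K) (e : 'I_d -> A) : A := \sum_i k (c i) * e i.

(** Vector spaces are classical sets inside a ring, with scalars acting through [k]. The graded
    pieces of R, those of Q^h(R) and the local rings are then all treated by the same lemmas. *)
Definition subspace V := V 0 /\ forall c u v, V u -> V v -> V (k c * u + v).

Lemma subspaceD V u v : subspace V -> V u -> V v -> V (u + v).
Proof. by move=> [_ h] Vu Vv; have := h 1 u v Vu Vv; rewrite rmorph1 mul1r. Qed.

Lemma subspaceZ V c u : subspace V -> V u -> V (k c * u).
Proof. by move=> [V0 h] Vu; have := h c u 0 Vu V0; rewrite addr0. Qed.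

Lemma subspaceN V u : subspace V -> V u -> V (- u).
Proof. by move=> sV /(subspaceZ (-1) sV); rewrite rmorphN1 mulN1r. Qed.

Lemma subspaceB V u v : subspace V -> V u -> V v -> V (u - v).
Proof. by move=> sV Vu Vv; apply: subspaceD => //; exact: subspaceN. Qed.

Lemma subspace_sum V (T : Type) (r : seq T) (P : pred T) (F : T -> A) :
  subspace V -> (forall i, P i -> V (F i)) -> V (\sum_(i <- r | P i) F i).
Proof.
move=> sV hF; apply: (big_ind V) => //; first by case: sV.
by move=> x y; exact: subspaceD.
Qed.

Lemma subspace_lincomb V d (c : 'I_d -> K) e :
  subspace V -> (forall i, V (e i)) -> V (lincomb c e).
Proof. by move=> sV Ve; apply: subspace_sum => // i _; exact: subspaceZ. Qed.

Lemma subspace0 : subspace [set 0].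
Proof. by split=> // c u v /= -> ->; rewrite mulr0 addr0. Qed.

Lemma lincombZ d (c : 'I_d -> K) e a :
  k a * lincomb c e = lincomb (fun i => a * c i) e.
Proof.
by rewrite mulr_sumr; apply: eq_bigr => i _ /=; rewrite rmorphM mulrA.
Qed.

Definition independent W d (e : 'I_d -> A) :=
  forall c : 'I_d -> K, W (lincomb c e) -> forall i, c i = 0.

Definition spans V W d (e : 'I_d -> A) :=
  forall v, V v -> exists c : 'I_d -> K, W (v - lincomb c e).

Lemma spans_subset V V' W d (e : 'I_d -> A) :
  V `<=` V' -> spans V' W e -> spans V W e.
Proof. by move=> sVV' h v /sVV' /h. Qed.

(** If d > d', the coefficient matrix [C] of the [e i] modulo [W] has a nonzero vector in its left
    kernel, which is a relation between the [e i] modulo [W]. *)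
Lemma steinitz V W d d' (e : 'I_d -> A) (e' : 'I_d' -> A) :
  subspace W -> independent W e -> spans V W e' -> (forall i, V (e i)) ->
  (d <= d')%N.
Proof.
move=> sW ie se Ve; rewrite leqNgt; apply/negP => ltd.
have /choice[c hc] i : exists c : 'I_d' -> K, W (e i - lincomb c e') := se _ (Ve i).
pose C := \matrix_(i, j) c i j.
have /row_subPn[i0 nz] : ~~ (kermx C <= (0 : 'M[K]_d))%MS.
  rewrite submx0 -mxrank_eq0 mxrank_ker subn_eq0 -ltnNge.
  by rewrite (leq_ltn_trans (rank_leq_col C)).
set u := row i0 (kermx C) in nz.
have uC : u *m C = 0 by rewrite -row_mul mulmx_ker row0.
have Wu : W (lincomb (fun i => u 0 i) e).
  suff -> : lincomb (fun i => u 0 i) e =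
     lincomb (fun i => u 0 i) (fun i => e i - lincomb (c i) e').
    exact: subspace_lincomb.
  apply: subr0_eq; rewrite -sumrB.
  transitivity (\sum_i \sum_j k (u 0 i * c i j) * e' j).
    apply: eq_bigr => i _; rewrite -mulrBr opprB addrCA subrr addr0 mulr_sumr.
    by apply: eq_bigr => j _; rewrite rmorphM mulrA.
  rewrite exchange_big big1 // => j _ /=; rewrite -mulr_suml -rmorph_sum /=.
  have /matrixP/(_ 0 j) := uC; rewrite !mxE => uCj.
  rewrite (_ : \sum_i _ = 0) ?rmorph0 ?mul0r // -[RHS]uCj.
  by apply: eq_bigr => i _; rewrite !mxE.
case/negP: nz; rewrite submx0; apply/eqP/rowP => i.
by rewrite (ie _ Wu) mxE.
Qed.

Lemma has_dim_uniq V W d d' : subspace W ->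
  has_dim k V W d -> has_dim k V W d' -> d = d'.
Proof.
move=> sW [e [Ve ie se]] [e' [Ve' ie' se']]; apply/eqP.
by rewrite eqn_leq (steinitz sW ie se' Ve) (steinitz sW ie' se Ve').
Qed.

Lemma dimK_eq V W d : subspace W -> has_dim k V W d -> dimK k V W = d.
Proof.
move=> sW hd; rewrite /dimK; case: xgetP => [x _ hx|/(_ d)//].
exact: has_dim_uniq hx hd.
Qed.

Definition extend d (v : A) (e : 'I_d -> A) (i : 'I_d.+1) : A :=
  oapp e v (unlift ord0 i).

Lemma lincomb_extend d v (e : 'I_d -> A) c :
  lincomb c (extend v e) =
  k (c ord0) * v + lincomb (fun i => c (lift ord0 i)) e.
Proof.
rewrite /lincomb big_ord_recl /extend unlift_none; congr (_ + _).
by apply: eq_bigr => i _; rewrite liftK.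
Qed.

Lemma mulkVK a x : a != 0 -> k a^-1 * (k a * x) = x.
Proof. by move=> a0; rewrite mulrA -rmorphM mulVf // rmorph1 mul1r. Qed.

Lemma independent_extend W d v (e : 'I_d -> A) :
  subspace W -> independent W e -> (forall c, ~ W (v - lincomb c e)) ->
  independent W (extend v e).
Proof.
move=> sW ie nv c; rewrite lincomb_extend => Wc.
have [c0|nz] := eqVneq (c ord0) 0.
  move: Wc; rewrite c0 rmorph0 mul0r add0r => /ie h i.
  by case: (unliftP ord0 i) => [j ->|->].
case: (nv (fun i => - (c ord0)^-1 * c (lift ord0 i))).
have := subspaceZ (c ord0)^-1 sW Wc.
by rewrite -lincombZ mulrDr mulkVK // rmorphN mulNr opprK.
Qed.

Lemma extend_in V d v (e : 'I_d -> A) :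
  V v -> (forall i, V (e i)) -> forall i, V (extend v e i).
Proof. by move=> Vv Ve i; rewrite /extend; case: unlift. Qed.

(** The generators need not lie in [V]: they only bound the length of the families of [V] that are
    independent modulo [W], and a family of maximal length is a basis. *)
Lemma has_dim_spanned V W m (g : 'I_m -> A) :
  subspace W -> spans V W g -> exists d, has_dim k V W d.
Proof.
move=> sW sg.
pose good d := `[< exists e : 'I_d -> A, independent W e /\ forall i, V (e i) >].
have good0 : exists d, good d.
  by exists 0%N; apply/asboolP; exists (fun=> 0); split=> [c _|] [].
have bound d : good d -> (d <= m)%N.
  by move=> /asboolP[e [ie Ve]]; exact: steinitz ie sg Ve.
case: (ex_maxnP good0 bound) => d /asboolP[e [ie Ve]] maxd.
exists d, e; split=> // v Vv; apply: contrapT => nv.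
suff /maxd : good d.+1 by rewrite ltnn.
apply/asboolP; exists (extend v e); split; last exact: extend_in.
by apply: independent_extend => // c Wc; apply: nv; exists c.
Qed.

Lemma has_dim_sub V V' W d : subspace W -> V' `<=` V -> has_dim k V W d ->
  exists d', has_dim k V' W d'.
Proof.
move=> sW sV [e [_ _ se]]; apply: has_dim_spanned => //.
exact: spans_subset sV se.
Qed.

Lemma has_dim_leq V V' W d d' : subspace W -> V' `<=` V ->
  has_dim k V' W d' -> has_dim k V W d -> (d' <= d)%N.
Proof.
move=> sW sV [e' [Ve' ie' _]] [e [_ _ se]].
by apply: steinitz ie' se _ => // i; exact: sV.
Qed.

Lemma has_dim_ltn V V' W d d' v : subspace W -> subspace V' -> W `<=` V' ->
  V' `<=` V -> V v -> ~ V' v ->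
  has_dim k V' W d' -> has_dim k V W d -> (d' < d)%N.
Proof.
move=> sW sV' sWV' sV Vv nv [e' [Ve' ie' _]] [e [_ _ se]].
have ie : independent W (extend v e').
  apply: independent_extend => // c /sWV' /(subspaceD sV').
  by move=> /(_ _ (subspace_lincomb c sV' Ve')); rewrite subrK.
apply: steinitz sW ie se _.
by apply: extend_in => // i; exact: sV.
Qed.

Lemma has_dim_eq V V' W d : subspace W -> subspace V' -> W `<=` V' ->
  V' `<=` V -> has_dim k V' W d -> has_dim k V W d -> V `<=` V'.
Proof.
move=> sW sV' sWV' sV h' h v Vv; apply: contrapT => nv.
by have := has_dim_ltn sW sV' sWV' sV Vv nv h' h; rewrite ltnn.
Qed.

Lemma has_dim_add V V' W a b : subspace W -> subspace V' -> W `<=` V' -> 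
  V' `<=` V -> has_dim k V' W a -> has_dim k V V' b -> has_dim k V W (a + b).
Proof.
move=> sW sV' sWV' sV [e [Ve ie se]] [f [Vf iff sf]].
pose g i := match split i with inl j => e j | inr j => f j end.
have gE c : lincomb c g =
    lincomb (fun i => c (lshift b i)) e + lincomb (fun i => c (rshift a i)) f.
  rewrite /lincomb big_split_ord /=; congr (_ + _); apply: eq_bigr => i _.
    by rewrite /g; case: split_ordP => j /eqP; rewrite ?eq_shift // => /eqP <-.
  by rewrite /g; case: split_ordP => j /eqP; rewrite ?eq_shift // => /eqP <-.
exists g; split.
- by move=> i; rewrite /g; case: split => j //; exact: sV.
- move=> c; change (W (lincomb c g) -> forall i, c i = 0); rewrite gE => Wc.
  have cr j : c (rshift a j) = 0.
    apply: (iff (fun i => c (rshift a i))).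
    rewrite -[X in V' X](addKr (lincomb (fun i => c (lshift b i)) e)) addrC.
    by apply: subspaceB => //; [exact: sWV'|exact: subspace_lincomb].
  move: Wc; rewrite [X in _ + X]big1 ?addr0 => [/ie cl|i _]; last first.
    by rewrite cr rmorph0 mul0r.
  by move=> i; case: (split_ordP i) => j ->.
- move=> v /sf[c hc]; have [c' hc'] := se _ hc.
  exists (fun i => match split i with inl j => c' j | inr j => c j end).
  change (W (v - lincomb (fun i => match split i with
             inl j => c' j | inr j => c j end) g)).
  rewrite gE opprD addrA addrAC; move: hc'; congr (W (_ - _ - _)).
    by apply: eq_bigr => i _; case: split_ordP => j /eqP; rewrite ?eq_shift // => /eqP <-.
  by apply: eq_bigr => i _; case: split_ordP => j /eqP; rewrite ?eq_shift // => /eqP <-.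
Qed.

Lemma has_dim0 W : subspace W -> has_dim k W W 0.
Proof.
move=> sW; exists (fun=> 0); split=> [[]//|c _ []//|v Wv].
by exists (fun=> 0); rewrite big_ord0 subr0.
Qed.

Lemma has_dim_sub0 V : has_dim k V [set 0] 0 -> V `<=` [set 0].
Proof. by move=> [e [_ _ se]] v /se[c]; rewrite big_ord0 subr0. Qed.

(** The matrix [M] of [beta] between [b] and [g] has full column rank, since a relation between its
    columns is a combination of the [g j] orthogonal to [V]. Every row vector, in particular the one
    with a single 1 at [j0], is therefore a combination of rows of [M]. *)
Lemma form_dual V m (b : 'I_m -> A) (beta : A -> A -> K) d (g : 'I_d -> A) j0 :
  subspace V -> (forall i, V (b i)) -> spans V [set 0] b ->
  (forall y c u v, V y -> V u -> V v ->
     beta y (k c * u + v) = c * beta y u + beta y v) ->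
  (forall y c u v, V y -> V u -> V v ->
     beta (k c * u + v) y = c * beta u y + beta v y) ->
  (forall a, V a -> (forall y, V y -> beta y a = 0) -> a = 0) ->
  (forall j, V (g j)) -> independent [set 0] g ->
  exists2 y, V y & forall j, beta y (g j) = (j == j0)%:R.
Proof.
move=> sV Vb sb linr linl nondeg Vg ig.
have V0 : V 0 by case: sV.
have beta0r y : V y -> beta y 0 = 0.
  move=> Vy; apply: addr_idem0; have := linr y 1 0 0 Vy V0 V0.
  by rewrite mulr0 add0r mul1r.
have beta0l y : V y -> beta 0 y = 0.
  move=> Vy; apply: addr_idem0; have := linl y 1 0 0 Vy V0 V0.
  by rewrite mulr0 add0r mul1r.
have sumr y n (c : 'I_n -> K) e : V y -> (forall i, V (e i)) ->
    beta y (lincomb c e) = \sum_i c i * beta y (e i).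
  move=> Vy; elim: n c e => [|n IH] c e Ve.
    by rewrite /lincomb !big_ord0 beta0r.
  rewrite /lincomb !big_ord_recl linr //; first by congr (_ + _); apply: IH.
  by apply: subspace_lincomb.
have suml y n (c : 'I_n -> K) e : V y -> (forall i, V (e i)) ->
    beta (lincomb c e) y = \sum_i c i * beta (e i) y.
  move=> Vy; elim: n c e => [|n IH] c e Ve.
    by rewrite /lincomb !big_ord0 beta0l.
  rewrite /lincomb !big_ord_recl linl //; first by congr (_ + _); apply: IH.
  by apply: subspace_lincomb.
pose M := \matrix_(i, j) beta (b i) (g j).
have Mfull : row_full M.
  rewrite /row_full -mxrank_tr -/(row_free _) -kermx_eq0.
  apply/eqP/row_matrixP => i.
  set u := row i _; rewrite row0.
  have uM : u *m M^T = 0 by rewrite -row_mul mulmx_ker row0.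
  apply/rowP => j; rewrite [RHS]mxE.
  apply: (ig (fun j => u 0 j)).
  apply: nondeg => [|y Vy]; first exact: subspace_lincomb.
  have [c /= /subr0_eq ->] := sb _ Vy.
  rewrite suml //; last exact: subspace_lincomb.
  rewrite big1 // => i' _; rewrite sumr //.
  have /matrixP/(_ 0 i') := uM; rewrite !mxE => uMi.
  rewrite (_ : \sum_i _ = 0) ?mulr0 // -[RHS]uMi.
  by apply: eq_bigr => l _; rewrite !mxE.
have /submxP[u hu] := submx_full (delta_mx 0 j0 : 'rV_d) Mfull.
exists (lincomb (fun i => u 0 i) b); first exact: subspace_lincomb.
move=> j; rewrite suml //.
have /matrixP/(_ 0 j) := hu; rewrite !mxE /= => ->.
by apply: eq_bigr => i _; rewrite mxE.
Qed.

(** This is the nontrivial half of biduality. A basis of [F] together with [x] is independent, and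
    [y] represents the functional that is 1 on [x] and 0 on that basis. *)
Lemma form_separates V n (beta : A -> A -> K) (F : set A) x :
  subspace V -> has_dim k V [set 0] n ->
  (forall y c u v, V y -> V u -> V v ->
     beta y (k c * u + v) = c * beta y u + beta y v) ->
  (forall y c u v, V y -> V u -> V v ->
     beta (k c * u + v) y = c * beta u y + beta v y) ->
  (forall a, V a -> (forall y, V y -> beta y a = 0) -> a = 0) ->
  subspace F -> F `<=` V -> V x -> ~ F x ->
  exists y, [/\ V y, forall f, F f -> beta y f = 0 & beta y x <> 0].
Proof.
move=> sV dV linr linl nondeg sF FV Vx nFx.
have [d [e [Fe ie se]]] := has_dim_sub subspace0 FV dV.
have [b [Vb _ sb]] := dV.
have ix : independent [set 0] (extend x e).
  apply: independent_extend => //; first exact: subspace0.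
  by move=> c /= /subr0_eq xE; apply: nFx; rewrite xE; exact: subspace_lincomb.
have Ve i : V (extend x e i) by apply: extend_in => // j; exact: FV.
have [y Vy hy] := form_dual ord0 sV Vb sb linr linl nondeg Ve ix.
have hye j : beta y (e j) = 0.
  by have := hy (lift ord0 j); rewrite /extend liftK /=.
exists y; split=> //; last first.
  have := hy ord0; rewrite /extend unlift_none eqxx /= => ->.
  by apply/eqP; rewrite oner_eq0.
move=> f /se[c /= /subr0_eq ->].
have {hye}: forall j, V (e j) /\ beta y (e j) = 0 by move=> j; split=> //; apply: FV.
rewrite -/(lincomb c e); clear -sV linr Vy; elim: d c e => [|d IH] c e he.
  have V0 : V 0 by case: sV.
  rewrite /lincomb big_ord0; apply: addr_idem0.
  by have := linr y 1 0 0 Vy V0 V0; rewrite mulr0 add0r mul1r.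
rewrite /lincomb big_ord_recl linr //; first 1 last.
- exact: (he _).1.
- by apply: subspace_lincomb => // i; exact: (he _).1.
by rewrite (he _).2 mulr0 add0r; exact: IH.
Qed.

End LinearSets.

(** * Dimensions along a linear map *)

Section Transport.
Variables (K : fieldType) (A B : pzRingType).
Variables (k : {rmorphism K -> A}) (l : {rmorphism K -> B}) (f : A -> B).
Variables (V W : set A) (V' W' : set B).
Hypothesis sV : subspace k V.
Hypothesis f_lin :
  forall c u v, V u -> V v -> f (k c * u + v) = l c * f u + f v.
Hypothesis fV : forall v, V v -> V' (f v).
Hypothesis f_surj : forall w, V' w -> exists2 v, V v & f v = w.
Hypothesis fW : forall v, V v -> W v <-> W' (f v).

Let f0 : f 0 = 0.
Proof.
have V0 : V 0 by case: sV.
apply: addr_idem0.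
by have := f_lin 1 V0 V0; rewrite rmorph1 mul1r addr0 rmorph1 mul1r.
Qed.

Let f_lincomb d (c : 'I_d -> K) e : (forall i, V (e i)) ->
  f (lincomb k c e) = lincomb l c (fun i => f (e i)).
Proof.
elim: d c e => [|d IH] c e Ve; first by rewrite /lincomb !big_ord0.
rewrite /lincomb !big_ord_recl f_lin //; first by congr (_ + _); exact: IH.
exact: subspace_lincomb.
Qed.

Let f_sub u v : V u -> V v -> f (u - v) = f u - f v.
Proof.
move=> Vu Vv; rewrite addrC -mulN1r -(rmorphN1 k) f_lin //.
by rewrite rmorphN1 mulN1r addrC.
Qed.

(** Linearity is asked on [V] alone, and [W] only has to be the preimage of [W'] within [V]. Under
    these hypotheses [f] induces an isomorphism of V/W with V'/W'. *)
Lemma has_dim_image d : has_dim k V W d -> has_dim l V' W' d.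
Proof.
move=> [e [Ve ie se]]; exists (fun i => f (e i)); split.
- by move=> i; exact: fV.
- move=> c; rewrite -/(lincomb _ _ _) -f_lincomb // => h i; apply: ie.
  by apply/fW => //; exact: subspace_lincomb.
- move=> w /f_surj[v Vv <-]; have [c hc] := se _ Vv; exists c.
  rewrite -/(lincomb _ _ _) -f_lincomb // -f_sub //; last exact: subspace_lincomb.
  by apply/fW; [apply: (subspaceB sV) => //; exact: subspace_lincomb|exact: hc].
Qed.

Lemma has_dim_preimage d : has_dim l V' W' d -> has_dim k V W d.
Proof.
move=> [e' [Ve' ie' se']].
have /choice[e he] i : exists v, V v /\ f v = e' i.
  by have [v] := f_surj (Ve' i); exists v.
have Ve i : V (e i) by case: (he i).
have e'E : e' = fun i => f (e i) by apply/funext => i; case: (he i).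
exists e; split=> //.
- move=> c Wc; apply: ie'; rewrite e'E -/(lincomb _ _ _) -f_lincomb //.
  by apply/fW => //; exact: subspace_lincomb.
- move=> v Vv; have [c hc] := se' _ (fV Vv); exists c.
  apply/fW; first by apply: (subspaceB sV) => //; exact: subspace_lincomb.
  rewrite f_sub //; last exact: subspace_lincomb.
  by rewrite f_lincomb //; move: hc; rewrite e'E.
Qed.

End Transport.

(** * Homogeneous prime ideals *)

(** A named function that can carry the ideal structures: points range over the type [prime_idealr],
    whereas the ideals built here are classical predicates. *)
Definition of_prime (R : comNzRingType) (S : {pred R}) (hS : idealr_closed S)
  (pS : prime_idealr_closed S) : R -> bool := fun x => x \in S.

Section OfPrime.
Variables (R : comNzRingType) (S : {pred R}) (hS : idealr_closed S)
  (pS : prime_idealr_closed S).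
HB.instance Definition _ := isIdealr.Build R (of_prime hS pS) hS.
HB.instance Definition _ := isPrimeIdealrClosed.Build R (of_prime hS pS) pS.

Lemma exists_prime_of : exists p : prime_idealr R, p =i S.
Proof. by exists (of_prime hS pS). Qed.

End OfPrime.

Section PrimeAvoidance.
Variables (R : comNzRingType) (J : set R) (h : R).
Hypothesis J0 : J 0.
Hypothesis JZ : forall a u v, J u -> J v -> J (a * u + v).
Hypothesis Jh : forall N, ~ J (h ^+ N).

Let good (X : set R) := [/\ J `<=` X, X 0,
  forall a u v, X u -> X v -> X (a * u + v) & forall N, ~ X (h ^+ N)].

(** Zorn's lemma for the ideals that contain [J] and no power of [h]. If u and v lie outside a
    maximal one, adjoining either of them captures a power of [h]; the product of the two
    expressions shows that u v lies outside as well. *)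
Lemma prime_avoidance :
  exists p : prime_idealr R, (forall x, J x -> x \in p) /\ h \notin p.
Proof.
have [M [PM maxM]] : exists M, (M = set0 \/ good M) /\
    forall B, M `<` B -> ~ (B = set0 \/ good B).
  apply: Zorn_bigcup => F FP Ftot.
  have [[X0 [FX0 gX0]]|none] := pselect (exists X, F X /\ good X); last first.
    left; rewrite -subset0 => x [X FX Xx].
    by have [X0|gX] := FP _ FX; [rewrite X0 in Xx|case: none; exists X].
  right; have gF X x : F X -> X x -> good X.
    by move=> FX Xx; have [X0'|//] := FP _ FX; rewrite X0' in Xx.
  split.
  - by move=> x Jx; exists X0 => //; case: gX0 => sJ *; exact: sJ.
  - by exists X0 => //; case: gX0.
  - move=> a u v [X FX Xu] [Y FY Yv].
    have [[_ _ XZ _] [_ _ YZ _]] := (gF _ _ FX Xu, gF _ _ FY Yv).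
    have [sXY|sYX] := Ftot _ _ FX FY.
      by exists Y => //; apply: YZ => //; exact: sXY.
    by exists X => //; apply: XZ => //; exact: sYX.
  - move=> N [X FX Xh]; by case: (gF _ _ FX Xh) => _ _ _ nX; exact: (nX N).
have [M0|[sJM M0 MZ Mh]] := PM.
  case: (maxM J).
    by rewrite M0; split=> // /(_ _ J0).
  by right; split.
have add1 f : ~ M f -> exists N a b, M b /\ h ^+ N = a * f + b.
  move=> nMf; pose B := [set x | exists a b, M b /\ x = a * f + b].
  apply: contrapT => noN; case: (maxM B).
    split; last first.
      move=> sBM; apply: nMf; apply: sBM; exists 1, 0.
      by rewrite mul1r addr0.
    by move=> x Mx; exists 0, x; rewrite mul0r add0r.
  right; split.
  - by move=> x /sJM Mx; exists 0, x; rewrite mul0r add0r.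
  - by exists 0, 0; rewrite mul0r add0r.
  - move=> a _ _ [b [c [Mc ->]]] [b' [c' [Mc' ->]]].
    by exists (a * b + b'), (a * c + c'); split; [exact: MZ|ring].
  - by move=> N [a [b [Mb e]]]; apply: noN; exists N, a, b.
have MX a u : M u -> M (a * u) by move=> /(MZ a)/(_ M0); rewrite addr0.
have hI : idealr_closed [pred x | `[< M x >]].
  split=> [||a u v /asboolP Mu /asboolP Mv]; first exact/asboolP.
    by apply/asboolP => M1; apply: (Mh 0%N); rewrite expr0.
  by apply/asboolP; exact: MZ.
have hP : prime_idealr_closed [pred x | `[< M x >]].
  move=> u v /asboolP Muv; apply/orP.
  have [Mu|/add1[N [a [b [Mb hN]]]]] := pselect (M u); first by left; apply/asboolP.
  have [Mv|/add1[N' [a' [b' [Mb' hN']]]]] := pselect (M v); first by right; apply/asboolP.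
  case: (Mh (N + N')%N); rewrite exprD hN hN'.
  have -> : (a * u + b) * (a' * v + b') =
     (a * a') * (u * v) + ((a' * v) * b + ((a * u) * b' + (b * b'))) by ring.
  by do !apply: (MZ) => //; apply: MX.
have [p pE] := exists_prime_of hI hP.
exists p; split=> [x /sJM Mx|]; rewrite pE; first exact/asboolP.
by apply/asboolP => Mh1; apply: (Mh 1%N); rewrite expr1.
Qed.

End PrimeAvoidance.

(** * Homogeneous components of polynomials and of primes *)

Section HomogeneousComponents.
Variables (K : fieldType) (n : nat).
Local Notation P := {mpoly K[n.+1]}.
Local Notation pi := (@pihomog n.+1 K mdeg).

Lemma pihomog_sum (f : P) N : (msize f <= N)%N -> f = \sum_(d < N) pi d f.
Proof. exact: pihomog_partitionE. Qed.

Lemma pihomog_homogM e d (f g : P) : f \is e.-homog for mdeg ->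
  pi (e + d) (f * g) = f * pi d g.
Proof.
move=> fe; have [le1 le2] := (leq_maxl (msize g) d.+1, leq_maxr (msize g) d.+1).
rewrite {1}(pihomog_sum le1) mulr_sumr linear_sum /=.
rewrite (bigD1 (Ordinal le2)) //= big1 ?addr0.
  by rewrite pihomog_dE // dhomogM // pihomogP.
move=> i ne; rewrite (@pihomog_ne0 _ _ _ (e + i)) ?dhomogM ?pihomogP //.
by rewrite eqn_add2l; apply: contra ne => /eqP e'; apply/eqP/val_inj.
Qed.

Lemma pihomog_homogM_lt e d (f g : P) : f \is e.-homog for mdeg ->
  (d < e)%N -> pi d (f * g) = 0.
Proof.
move=> fe lt; rewrite (pihomog_sum (leqnn (msize g))) mulr_sumr linear_sum /=.
apply: big1 => i _; rewrite (@pihomog_ne0 _ _ _ (e + i)) ?dhomogM ?pihomogP //.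
by rewrite neq_ltn (leq_trans lt) ?leq_addr ?orbT.
Qed.

Lemma pihomogM d (f g : P) :
  pi d (f * g) = \sum_(i < d.+1) pi i f * pi (d - i) g.
Proof.
have [le1 le2] := (leq_maxl (msize f) d.+1, leq_maxr (msize f) d.+1).
rewrite {1}(pihomog_sum le1) mulr_suml linear_sum /=.
rewrite (big_ord_widen _ (fun i => pi i f * pi (d - i) g) le2) [RHS]big_mkcond /=.
apply: eq_bigr => i _; case: ssrnat.ltnP => hi; last first.
  by apply: pihomog_homogM_lt hi; exact: pihomogP.
have {1}-> : d = (i + (d - i))%N by rewrite subnKC.
by rewrite (pihomog_homogM _ _ (pihomogP _ _ _)).
Qed.

(** The core is the largest homogeneous ideal inside [p]. For primality, take the components of u
    and v of least degrees d and c outside [p]: in the component of degree d + c of u v all other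
    terms lie in [p], so this component does not. *)
Lemma homogeneous_core (p : prime_idealr P) : exists q : prime_idealr P,
  homogeneous q /\ forall f, f \in q <-> forall d, pi d f \in p.
Proof.
pose S : {pred P} := [pred f | `[< forall d, pi d f \in p >]].
have SP f : reflect (forall d, pi d f \in p) (f \in S) by exact: asboolP.
have hI : idealr_closed S.
  split=> [||a u v /SP hu /SP hv]; apply/SP.
  - by move=> d; rewrite linear0 rpred0.
  - by move=> /(_ 0%N); rewrite pihomog_dE ?dhomog1 ?idealr1.
  - move=> d; rewrite pihomogD pihomogM rpredD ?hv ?rpred_sum // => i _.
    exact: idealMr.
have hP : prime_idealr_closed S.
  move=> u v /SP huv; apply/orP.
  have [uS|nu] := boolP (u \in S); [by left|right].
  apply/SP => e; apply: contrapT => /negP nv.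
  have /existsNP[d0 /negP nu0] : ~ forall d, pi d u \in p by apply/SP.
  have eu : exists d, pi d u \notin p by exists d0.
  have ev : exists d, pi d v \notin p by exists e.
  case: (ex_minnP eu) => d nd mind; case: (ex_minnP ev) => c nc minc.
  have := huv (d + c)%N; rewrite pihomogM.
  have dlt : (d < (d + c).+1)%N by rewrite ltnS leq_addr.
  rewrite (bigD1 (Ordinal dlt)) //= rpredDr; last first.
    apply: rpred_sum => i ne; have [lt|gt|eq] := ssrnat.ltngtP i d.
    - rewrite mulrC idealMr //; apply: contraLR (lt); rewrite -leqNgt.
      exact: mind.
    - rewrite idealMr //; apply: contraLR (gt) => /minc; rewrite -leqNgt.
      move=> le; rewrite -(leq_add2r c) (leq_trans (leq_add (leqnn i) le)) //.
      by rewrite subnKC // -ltnS.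
    - by case/eqP: ne; apply: val_inj.
  by rewrite addKn prime_idealrM (negbTE nd) (negbTE nc).
have [q qE] := exists_prime_of hI hP; exists q; split.
  move=> f d; rewrite !qE => /SP hf; apply/SP => c.
  have [<-|ne] := eqVneq d c; first by rewrite pihomog_id.
  by rewrite (@pihomog_ne0 _ _ _ d) ?pihomogP // rpred0.
by move=> f; rewrite qE; split=> /SP.
Qed.

(** The homogeneous core of a prime avoiding [h] still contains the homogeneous ideal [J] and still
    avoids the form [h]. This is how points are produced, both for the nilpotency of the variables
    modulo x_0 and for the injectivity of germs. *)
Lemma homogeneous_prime_avoidance (J : set P) (h : P) e :
  J 0 -> (forall a u v, J u -> J v -> J (a * u + v)) ->
  (forall f d, J f -> J (pi d f)) -> h \is e.-homog for mdeg ->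
  (forall N, ~ J (h ^+ N)) ->
  exists q : prime_idealr P,
    [/\ homogeneous q, forall f, J f -> f \in q & h \notin q].
Proof.
move=> J0 JZ Jpi he Jh; have [p [Jp hp]] := prime_avoidance J0 JZ Jh.
have [q [hq qE]] := homogeneous_core p; exists q; split=> //.
  by move=> f Jf; apply/qE => d; apply: Jp; exact: Jpi.
by apply: contra hp => /qE /(_ e); rewrite pihomog_dE.
Qed.

End HomogeneousComponents.

(** * The coordinate ring *)

Section CoordinateRing.
Variables (K : fieldType) (n : nat) (I : idealr {mpoly K[n.+1]}).
Local Notation P := {mpoly K[n.+1]}.
Local Notation pi := (@pihomog n.+1 K mdeg).
Local Notation R := (coord_ring I).
Local Notation cls := (@cls K n I).
Local Notation kR := (@kR K n I).
Local Notation gr := (@grR K n I).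
Local Notation hnzd := (@hnzd K n I).
Local Notation x0 := (x0 I).

Lemma cls_is_zmod_morphism : zmod_morphism cls.
Proof. exact: clsB. Qed.
HB.instance Definition _ :=
  GRing.isZmodMorphism.Build P R cls cls_is_zmod_morphism.

Lemma cls_is_monoid_morphism : monoid_morphism cls.
Proof. by split; [exact: cls1|exact: clsM]. Qed.
HB.instance Definition _ :=
  GRing.isMonoidMorphism.Build P R cls cls_is_monoid_morphism.

Lemma kR_is_zmod_morphism : zmod_morphism kR.
Proof. by move=> x y; rewrite /kR mpolyCB rmorphB. Qed.
HB.instance Definition _ :=
  GRing.isZmodMorphism.Build K R kR kR_is_zmod_morphism.

Lemma kR_is_monoid_morphism : monoid_morphism kR.
Proof. by split=> [|x y]; rewrite /kR ?mpolyC1 ?rmorph1 // mpolyCM rmorphM. Qed.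
HB.instance Definition _ :=
  GRing.isMonoidMorphism.Build K R kR kR_is_monoid_morphism.

Lemma cls_eq f g : cls f = cls g <-> f - g \in I.
Proof.
rewrite Quotient.idealrBE; split=> [e|/eqP]; first exact/eqP.
exact.
Qed.

Lemma cls_eq0 f : cls f = 0 <-> f \in I.
Proof. by rewrite -(rmorph0 cls) cls_eq subr0. Qed.

Lemma cls_surj x : exists f, x = cls f.
Proof. by exists (repr x); rewrite /cls reprK. Qed.

Lemma clsZ c f : cls (c *: f) = kR c * cls f.
Proof. by rewrite -mul_mpolyC rmorphM. Qed.

Lemma gr0 i : gr i 0.
Proof. by case: i => // d; exists 0; rewrite ?dhomog0 ?rmorph0. Qed.

Lemma gr_kR c : gr 0 (kR c).
Proof. by exists c%:MP => //; rewrite -[c%:MP]mulr1 mul_mpolyC dhomogZ // dhomog1. Qed.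

Lemma subspace_gr i : subspace kR (gr i).
Proof.
split=> [|c u v hu hv]; first exact: gr0.
rewrite -[v]opprK; apply: grRB.
  by rewrite -[i]add0r; apply: grRM => //; exact: gr_kR.
by rewrite -sub0r; apply: grRB => //; exact: gr0.
Qed.

Lemma dhomog_var i : ('X_i : P) \is 1.-homog for mdeg.
Proof. by rewrite dhomogX; apply/eqP; exact: mdeg1. Qed.

Lemma pihomogMX d (g : P) : pi d.+1 (g * 'X_ord0) = pi d g * 'X_ord0.
Proof.
by rewrite ![_ * 'X_ord0]mulrC; exact: (pihomog_homogM d g (dhomog_var ord0)).
Qed.

Lemma pihomogMX0 (g : P) : pi 0 (g * 'X_ord0) = 0.
Proof. by rewrite mulrC (pihomog_homogM_lt _ (dhomog_var ord0)). Qed.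

Lemma gr_x0 : gr 1 x0.
Proof. by exists 'X_ord0 => //; exact: dhomog_var. Qed.

Lemma gr_x0X m : gr m%:Z (x0 ^+ m).
Proof.
elim: m => [|m IH]; first exact: grR1.
by rewrite exprS -add1n PoszD; apply: grRM => //; exact: gr_x0.
Qed.

Lemma coord_has_dim i : exists d, has_dim kR (gr i) [set 0] d.
Proof.
case: i => d; last by exists 0%N; apply: has_dim0; exact: subspace0.
pose T := 'X_{1..n.+1 < d.+1}.
apply: (@has_dim_spanned _ _ _ _ _ #|{: T}| (fun i => cls 'X_[(enum_val i : T)])).
  exact: subspace0.
move=> _ [f fd ->]; exists (fun i => f@_(enum_val i : T)) => /=.
apply/eqP; rewrite subr_eq0; apply/eqP.
have sz : (msize f <= d.+1)%N.
  rewrite mmeasureE; apply/bigmax_leqP_seq => m mf _.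
  by rewrite (dhomog_mf fd mf).
rewrite {1}(mpolywE sz) rmorph_sum /=.
rewrite (reindex (@enum_val T predT)) /=; last exact: onW_bij (enum_val_bij _).
by apply: eq_bigr => i _; rewrite clsZ.
Qed.

Hypothesis hI : homogeneous I.

Definition rcomp (i : int) (x : R) : R :=
  if i is Posz d then cls (pi d (repr x)) else 0.

Lemma rcompE d f : rcomp (Posz d) (cls f) = cls (pi d f).
Proof.
apply/cls_eq; rewrite -pihomogB; apply: hI; apply/cls_eq.
by rewrite /Defs.cls reprK.
Qed.

Lemma rcomp_lin i c x y : rcomp i (kR c * x + y) = kR c * rcomp i x + rcomp i y.
Proof.
case: i => [d|d] /=; last by rewrite mulr0 addr0.
have [[f ->] [g ->]] := (cls_surj x, cls_surj y).
rewrite -clsZ -rmorphD -!/(rcomp (Posz d) _) !rcompE pihomogD -clsZ -rmorphD.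
by rewrite linearZ.
Qed.

Lemma rcompD i : {morph rcomp i : x y / x + y}.
Proof. by move=> x y; have := rcomp_lin i 1 x y; rewrite rmorph1 !mul1r. Qed.

Lemma rcomp0 i : rcomp i 0 = 0.
Proof. by apply: addr_idem0; rewrite -rcompD addr0. Qed.

Lemma rcompZ i c x : rcomp i (kR c * x) = kR c * rcomp i x.
Proof. by have := rcomp_lin i c x 0; rewrite rcomp0 !addr0. Qed.

Lemma rcomp_sumE i (T : Type) (r : seq T) (F : T -> R) :
  rcomp i (\sum_(j <- r) F j) = \sum_(j <- r) rcomp i (F j).
Proof. by apply: big_morph; [exact: rcompD|exact: rcomp0]. Qed.

Lemma gr_rcomp i x : gr i (rcomp i x).
Proof. by case: i => // d; exists (pi d (repr x)) => //; exact: pihomogP. Qed.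

Lemma rcomp_id i x : gr i x -> rcomp i x = x.
Proof.
case: i => [d [f fd ->]|d -> //]; by rewrite rcompE pihomog_dE.
Qed.

Lemma rcomp_ne0 i j x : gr i x -> i != j -> rcomp j x = 0.
Proof.
case: i => [d [f fd ->]|d ->]; last by rewrite rcomp0.
case: j => // e ne; rewrite rcompE (@pihomog_ne0 _ _ _ d) ?rmorph0 //.
Qed.

Lemma rcomp_neg i x : i < 0 -> rcomp i x = 0.
Proof. by case: i. Qed.

Lemma rcomp_sum x : exists N, x = \sum_(d < N) rcomp d%:Z x.
Proof.
have [f ->] := cls_surj x; exists (msize f).
rewrite {1}(pihomog_sum (leqnn (msize f))) rmorph_sum.
by apply: eq_bigr => i _; rewrite rcompE.
Qed.

Lemma rcompM i j x y : gr i x -> rcomp (i + j) (x * y) = x * rcomp j y.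
Proof.
case: i => [d|d ->]; last by rewrite !mul0r rcomp0.
move=> [f fd ->]; have [g ->] := cls_surj y; rewrite -clsM.
case: j => j; first by rewrite rcompE -PoszD rcompE -clsM pihomog_homogM.
rewrite [rcomp (Negz j) _]/= mulr0 NegzE.
case: (ltnP d j.+1) => [lt|le].
  have -> : d%:Z - j.+1%:Z = Negz (j - d).
    by rewrite NegzE -subSn // -subzn ?opprB // ltnW.
  by [].
rewrite subzn // rcompE (pihomog_homogM_lt _ fd) ?rmorph0 //.
by rewrite ltn_subrL /= (leq_trans _ le).
Qed.

Lemma coord_neq0 : 1 != 0 :> R.
Proof. exact: oner_neq0. Qed.

Hypothesis sat : saturated I.
Hypothesis hx0 : forall p, Defs.point I p -> 'X_ord0 \notin p.

(* No point lies on X_0 = 0, so every X_i is nilpotent in R / (x_0). *)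
Lemma nilpotent_mod_x0 (i : 'I_n.+1) : exists N g, 'X_i ^+ N - g * 'X_ord0 \in I.
Proof.
apply: contrapT => no.
pose J := [set f : P | exists g, f - g * 'X_ord0 \in I].
have [|||||q [hq Jq nq]] := @homogeneous_prime_avoidance _ _ J 'X_i 1%N.
- by exists 0; rewrite mul0r subr0 rpred0.
- move=> a u v [g hg] [h hh]; exists (a * g + h).
  have -> : a * u + v - (a * g + h) * 'X_ord0 =
    a * (u - g * 'X_ord0) + (v - h * 'X_ord0) by ring.
  by rewrite rpredD // idealMr.
- move=> f [|d] [g hg]; [exists 0|exists (pi d g)].
    by rewrite mul0r; have := hI 0 hg; rewrite pihomogB pihomogMX0.
  by have := hI d.+1 hg; rewrite pihomogB pihomogMX.
- exact: dhomog_var.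
- by move=> N [g hg]; apply: no; exists N, g.
have : Defs.point I q.
  split=> //; last by exists i.
  by move=> f fI; apply: Jq; exists 0; rewrite mul0r subr0.
move=> /hx0/negP; apply; apply: Jq; exists 1.
by rewrite mul1r subrr rpred0.
Qed.

(** Pigeonhole: a monomial whose degree exceeds the sum of the nilpotency exponents is divisible by
    some ['X_i ^+ N i]. *)
Lemma x0_onto_monomials : exists N, forall m : 'X_{1..n.+1}, (N <= mdeg m)%N ->
  exists g : P, 'X_[m] - g * 'X_ord0 \in I.
Proof.
have /choice[N hN] : forall i : 'I_n.+1, exists N, exists g, 'X_i ^+ N - g * 'X_ord0 \in I.
  exact: nilpotent_mod_x0.
exists (\sum_i N i).+1 => m; rewrite mdegE => hm.
have [i hi] : exists i, (N i <= m i)%N.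
  apply: contrapT => no; move: hm; rewrite ltnNge leq_sum // => i _.
  by rewrite leqNgt; apply/negP => lt; apply: no; exists i; exact: ltnW.
have [g hg] := hN i; exists ('X_[m - U_(i) *+ N i] * g).
have {1}-> : m = ((m - U_(i) *+ N i) + U_(i) *+ N i)%MM.
  rewrite submK //; apply/mnm_lepP => j; rewrite mulmnE mnm1E.
  by case: eqVneq => [<-|]; rewrite ?mul1n ?mul0n.
by rewrite mpolyXD -mpolyXn -mulrA -mulrBr idealMr.
Qed.

(** This is the finiteness of R over K[x_0], in the form that R is generated in degrees at most [D].
    A form is reduced monomial by monomial, and a component of the quotient is taken at the end. *)
Lemma x0_onto : exists D, forall d, (D <= d)%N -> forall x, gr d.+1%:Z x ->
  exists2 y, gr d%:Z y & x = x0 * y.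
Proof.
have [N hN] := x0_onto_monomials; exists N => d le _ [f fd ->].
suff [g hg] : exists g, f - g * 'X_ord0 \in I.
  exists (cls (pi d g)); first by exists (pi d g) => //; exact: pihomogP.
  rewrite /Defs.x0 -clsM; apply/cls_eq; have := hI d.+1 hg.
  by rewrite pihomogB pihomog_dE // pihomogMX mulrC.
rewrite [f]mpolyE big_seq; elim/big_ind: _ => [|u v [g hg] [h hh]|m mf].
- by exists 0; rewrite mul0r subr0 rpred0.
- by exists (g + h); rewrite mulrDl opprD addrACA rpredD.
- have [|g hg] := hN m; first by rewrite (dhomog_mf fd mf) (leq_trans le).
  by exists (f@_m *: g); rewrite -scalerAl -scalerBr -mul_mpolyC idealMr.
Qed.

(** Modulo [I] every form of degree [D.+1] is a multiple of x_0, so an element killed by x_0 is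
    killed by all these forms and vanishes by saturation. *)
Lemma x0_reg x : x0 * x = 0 -> x = 0.
Proof.
have [f ->] := cls_surj x => fx0; have [D hD] := x0_onto.
apply/cls_eq0; apply: sat; exists D.+1 => h hd; apply/cls_eq0.
have [|y _ hy] := hD D (leqnn D) (cls h); first by exists h.
by rewrite clsM hy mulrAC fx0 mul0r.
Qed.

Lemma x0X_reg m x : x0 ^+ m * x = 0 -> x = 0.
Proof.
elim: m => [|m IH]; first by rewrite mul1r.
by rewrite exprS -mulrA => /x0_reg.
Qed.

Lemma x0X_onto : exists D, forall d m, (D <= d)%N -> forall x, gr (d + m)%:Z x ->
  exists2 y, gr d%:Z y & x = x0 ^+ m * y.
Proof.
have [D hD] := x0_onto; exists D => d m le; elim: m => [|m IH] x hx.
  by exists x; rewrite ?mul1r // -[d]addn0.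
have [||y hy ->] := hD (d + m)%N _ x; rewrite -?addnS //.
  by rewrite (leq_trans le) // leq_addr.
by have [z hz ->] := IH _ hy; exists z => //; rewrite exprS mulrA.
Qed.

Lemma hnzd_x0X m : x0 ^+ m \in hnzd.
Proof.
apply/asboolP; split; first by exists m%:Z; exact: gr_x0X.
by move=> y; exact: x0X_reg.
Qed.

Lemma gr_dim_const : exists D N, forall d, (D <= d)%N ->
  has_dim kR (gr d%:Z) [set 0] N.
Proof.
have [D hD] := x0X_onto; have [N hN] := coord_has_dim D.
exists D, N => d le; rewrite -(subnKC le).
apply: (has_dim_image (f := fun x => x0 ^+ (d - D) * x) _ _ _ _ _ hN).
- exact: subspace_gr.
- by move=> c u v _ _; rewrite mulrDr mulrCA.
- by move=> v Dv; rewrite addnC PoszD; apply: grRM => //; exact: gr_x0X.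
- by move=> w /(hD _ _ (leqnn D))[v Dv ->]; exists v.
- by move=> v _; split=> /= [->|/x0X_reg]; rewrite ?mulr0.
Qed.

(** Multiplication by [f] is injective from R_D to R_(D+e), and both have dimension [N] when [D] is
    large. It is thus onto and reaches x_0^(D+e). *)
Lemma hnzd_dvd_x0X f : f \in hnzd -> exists g M, f * g = x0 ^+ M.
Proof.
move=> /asboolP[[[e fe|e ->]] freg]; last first.
  by have /eqP := freg 1 (mul0r 1); rewrite (negbTE coord_neq0).
have [D [N hN]] := gr_dim_const.
pose V := [set f * x | x in gr D%:Z].
have sV : subspace kR V.
  have [g0 gD] := subspace_gr D%:Z.
  split; first by exists 0; rewrite ?mulr0.
  move=> c _ _ [x hx <-] [y hy <-]; exists (kR c * x + y); first exact: gD.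
  by rewrite mulrDr mulrCA.
have dV : has_dim kR V [set 0] N.
  apply: (has_dim_image (f := fun x => f * x) _ _ _ _ _ (hN D (leqnn D))).
  - exact: subspace_gr.
  - by move=> c u v _ _; rewrite mulrDr mulrCA.
  - by move=> v Dv; exists v.
  - by move=> _ [x hx <-]; exists x.
  - by move=> v _; split=> /= [->|/freg]; rewrite ?mulr0.
have sub : V `<=` gr (D + e)%:Z.
  by move=> _ [x hx <-]; rewrite addnC PoszD; exact: grRM.
have sub0 : [set 0] `<=` V by move=> _ ->; case: sV.
have eqV := has_dim_eq (subspace0 _) sV sub0 sub dV (hN _ (leq_addr e D)).
have [g _ hg] := eqV _ (gr_x0X (D + e)).
by exists g, (D + e)%N.
Qed.

End CoordinateRing.
Arguments rcomp : simpl never.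

(** * The homogeneous ring of quotients *)

Section HomogeneousLocalization.
Variables (K : fieldType) (n : nat) (I : idealr {mpoly K[n.+1]}).
Local Notation R := (coord_ring I).
Local Notation kR := (@kR K n I).
Local Notation gr := (@grR K n I).
Local Notation hnzd := (@hnzd K n I).
Local Notation x0 := (x0 I).
Local Notation Q := (Qh I).
Local Notation iota := (@Defs.iota K n I).
Local Notation kQ := (@kQ K n I).
Local Notation grQ := (@grQ K n I).

Let S1 : 1 \in hnzd. Proof. exact: rpred1. Qed.

Lemma iota_is_zmod_morphism : zmod_morphism iota.
Proof. by move=> x y; rewrite /Defs.iota fracN fracD // !mulr1. Qed.
HB.instance Definition _ :=
  GRing.isZmodMorphism.Build R Q iota iota_is_zmod_morphism.

Lemma iota_is_monoid_morphism : monoid_morphism iota.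
Proof. by split=> [|x y]; rewrite /Defs.iota ?frac1 // fracM // mulr1. Qed.
HB.instance Definition _ :=
  GRing.isMonoidMorphism.Build R Q iota iota_is_monoid_morphism.

Lemma kQ_is_zmod_morphism : zmod_morphism kQ.
Proof. by move=> x y; rewrite /kQ !rmorphB. Qed.
HB.instance Definition _ :=
  GRing.isZmodMorphism.Build K Q kQ kQ_is_zmod_morphism.

Lemma kQ_is_monoid_morphism : monoid_morphism kQ.
Proof. by split=> [|x y]; rewrite /kQ ?rmorph1 // !rmorphM. Qed.
HB.instance Definition _ :=
  GRing.isMonoidMorphism.Build K Q kQ kQ_is_monoid_morphism.

Hypothesis hI : homogeneous I.
Hypothesis sat : saturated I.
Hypothesis hx0 : forall p, Defs.point I p -> 'X_ord0 \notin p.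

Let SX m : x0 ^+ m \in hnzd. Proof. exact: hnzd_x0X. Qed.

Definition fx (f : R) (m : nat) : Q := Defs.frac hnzd f (x0 ^+ m).

Lemma fx_eq f m g p : fx f m = fx g p <-> f * x0 ^+ p = g * x0 ^+ m.
Proof.
rewrite frac_eqP //; split=> [[w /asboolP[_ wreg] /wreg/subr0_eq //]|->].
by exists 1; rewrite // subrr mulr0.
Qed.

Lemma fx_surj z : exists f m, z = fx f m.
Proof.
have [f [g [gS ->]]] := frac_repr z.
have [h [M ghM]] := hnzd_dvd_x0X hI sat hx0 gS.
exists (f * h), M; apply/frac_eqP => //; exists 1 => //.
by rewrite -ghM; ring.
Qed.

Lemma fx0 f : fx f 0 = iota f. Proof. by []. Qed.

Lemma fxD f g m : fx f m + fx g m = fx (f + g) m.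
Proof.
by rewrite /fx fracD //; apply/frac_eqP; rewrite ?rpredM //; exists 1 => //; ring.
Qed.

Lemma fxM f m g p : fx f m * fx g p = fx (f * g) (m + p).
Proof. by rewrite /fx fracM // exprD. Qed.

Lemma fxN f m : - fx f m = fx (- f) m.
Proof. exact: fracN. Qed.

Lemma fx_shift p f m : fx (x0 ^+ p * f) (p + m) = fx f m.
Proof. by apply/fx_eq; rewrite exprD; ring. Qed.

Lemma fx0l m : fx 0 m = 0.
Proof.
have <- : fx 0 0 = 0 by rewrite fx0 rmorph0.
by apply/fx_eq; rewrite !mul0r.
Qed.

Lemma iota_inj : injective iota.
Proof. by move=> x y; rewrite -!fx0 => /fx_eq; rewrite !mulr1. Qed.

Lemma iotaM_fx x f m : iota x * fx f m = fx (x * f) m.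
Proof. by rewrite -fx0 fxM. Qed.

Lemma kQM_fx c f m : kQ c * fx f m = fx (kR c * f) m.
Proof. exact: iotaM_fx. Qed.

(** The unit x_0^i of Q^h(R) for an integer exponent; multiplication by it moves the degree 0 piece
    to degree i. *)
Definition xq (i : int) : Q :=
  match i with Posz m => iota (x0 ^+ m) | Negz m => fx 1 m.+1 end.

Lemma xq_Nnat m : xq (- m%:Z) = fx 1 m.
Proof. by case: m => [|m] //; rewrite oppr0 /= -fx0. Qed.

Lemma xq_subnat a b : xq (a%:Z - b%:Z) = fx (x0 ^+ a) b.
Proof.
case: (leqP b a) => [le|/ltnW le].
  rewrite subzn //= -fx0; apply/fx_eq.
  by rewrite mulr1 -exprD subnK.
rewrite -opprB subzn // xq_Nnat; apply/fx_eq.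
by rewrite mul1r -exprD subnKC.
Qed.

Lemma int_subnat (i : int) : exists a b : nat, i = a%:Z - b%:Z.
Proof.
case: i => m; first by exists m, 0%N; rewrite subr0.
by exists 0%N, m.+1; rewrite sub0r NegzE.
Qed.

Lemma xqD i j : xq (i + j) = xq i * xq j.
Proof.
have [[a [b ->]] [c [d ->]]] := (int_subnat i, int_subnat j).
have -> : a%:Z - b%:Z + (c%:Z - d%:Z) = (a + c)%N%:Z - (b + d)%N%:Z.
  by rewrite !PoszD; ring.
by rewrite !xq_subnat fxM -exprD.
Qed.

Lemma xq0 : xq 0 = 1.
Proof. by rewrite /= expr0 rmorph1. Qed.

Lemma xqK i z : xq (- i) * (xq i * z) = z.
Proof. by rewrite mulrA -xqD addNr xq0 mul1r. Qed.

Lemma xqVK i z : xq i * (xq (- i) * z) = z.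
Proof. by rewrite mulrA -xqD subrr xq0 mul1r. Qed.

Lemma fxE f m : fx f m = iota f * xq (- m%:Z).
Proof. by rewrite xq_Nnat iotaM_fx mulr1. Qed.

Lemma grQP i z : grQ i z <-> exists f m, gr (i + m%:Z) f /\ z = fx f m.
Proof.
split=> [[d [e [f [g [fd ge gS -> ->]]]]]|[f [m [fd ->]]]]; last first.
  exists (i + m%:Z), m%:Z, f, (x0 ^+ m); split=> //; last by rewrite addrK.
  exact: gr_x0X.
have [h [M ghM]] := hnzd_dvd_x0X hI sat hx0 gS.
(* Since [g] and x_0^M are homogeneous, only one component of the cofactor contributes to the
   product, and it can replace [h]. *)
pose h' := rcomp (M%:Z - e) h.
have gh' : g * h' = x0 ^+ M.
  rewrite /h' -(rcompM hI _ _ ge) ghM addrC subrK (rcomp_id hI) //.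
  exact: gr_x0X.
exists (f * h'), M; split.
  have -> : d - e + M%:Z = d + (M%:Z - e) by ring.
  by apply: grRM => //; exact: gr_rcomp.
apply/frac_eqP => //; exists 1 => //.
by rewrite -gh'; ring.
Qed.

Lemma grQ_fx i m f : gr (i + m%:Z) f -> grQ i (fx f m).
Proof. by move=> h; apply/grQP; exists f, m. Qed.

Lemma grQM i j z w : grQ i z -> grQ j w -> grQ (i + j) (z * w).
Proof.
move=> /grQP[f [m [hf ->]]] /grQP[g [p [hg ->]]]; rewrite fxM.
apply: grQ_fx; rewrite PoszD.
have -> : i + j + (m%:Z + p%:Z) = (i + m%:Z) + (j + p%:Z) by ring.
exact: grRM.
Qed.

Lemma grQ_iota i x : gr i x -> grQ i (iota x).
Proof. by move=> hx; apply: (@grQ_fx i 0); rewrite addr0. Qed.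

Lemma grQ_xq i : grQ i (xq i).
Proof.
have [a [b ->]] := int_subnat i; rewrite xq_subnat; apply: grQ_fx.
by rewrite subrK; exact: gr_x0X.
Qed.

Lemma grQ_kQ c : grQ 0 (kQ c).
Proof. by apply: grQ_iota; exact: gr_kR. Qed.

Lemma grQ_one : grQ 0 1.
Proof. by have := grQ_kQ 1; rewrite rmorph1. Qed.

Lemma subspace_grQ i : subspace kQ (grQ i).
Proof.
split=> [|c u v /grQP[f [m [hf ->]]] /grQP[g [p [hg ->]]]].
  by rewrite -(fx0l 0); apply: grQ_fx; exact: gr0.
rewrite kQM_fx -(fx_shift p) -(fx_shift m g p) addnC fxD; apply: grQ_fx.
apply: (subspaceD (subspace_gr I _)).
  have -> : i + (m + p)%N%:Z = p%:Z + (i + m%:Z) by rewrite PoszD; ring.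
  apply: grRM; first exact: gr_x0X.
  exact: subspaceZ (subspace_gr _ _) _.
have -> : i + (m + p)%N%:Z = m%:Z + (i + p%:Z) by rewrite PoszD; ring.
by apply: grRM => //; exact: gr_x0X.
Qed.

(** Computed on a chosen fraction with denominator a power of x_0; [qcompE] shows that the choice is
    immaterial. *)
Definition qcomp (i : int) (z : Q) : Q :=
  let f := projT1 (cid (fx_surj z)) in
  let m := projT1 (cid (projT2 (cid (fx_surj z)))) in
  fx (rcomp (i + m%:Z) f) m.

Lemma rcomp_x0X i m x : rcomp (m%:Z + i) (x0 ^+ m * x) = x0 ^+ m * rcomp i x.
Proof. by rewrite (rcompM hI _ _ (gr_x0X _ _)). Qed.

Lemma qcompE i f m : qcomp i (fx f m) = fx (rcomp (i + m%:Z) f) m.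
Proof.
rewrite /qcomp; case: (cid (fx_surj _)) => g /= hg.
case: cid => p /= /fx_eq e; apply/fx_eq.
rewrite mulrC -rcomp_x0X mulrC -e [RHS]mulrC -rcomp_x0X [f * _]mulrC.
by congr (rcomp _ _); ring.
Qed.

Lemma qcompD i : {morph qcomp i : z w / z + w}.
Proof.
move=> z w; have [[f [m ->]] [g [p ->]]] := (fx_surj z, fx_surj w).
rewrite -(fx_shift p f) -(fx_shift m g p) [(m + p)%N]addnC fxD !qcompE fxD.
by rewrite (rcompD hI).
Qed.

Lemma qcomp0 i : qcomp i 0 = 0.
Proof. by apply: addr_idem0; rewrite -qcompD addr0. Qed.

Lemma qcomp_sumE i (T : Type) (r : seq T) (F : T -> Q) :
  qcomp i (\sum_(j <- r) F j) = \sum_(j <- r) qcomp i (F j).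
Proof. by apply: big_morph; [exact: qcompD|exact: qcomp0]. Qed.

Lemma grQ_qcomp i z : grQ i (qcomp i z).
Proof.
have [f [m ->]] := fx_surj z; rewrite qcompE; apply: grQ_fx.
exact: gr_rcomp.
Qed.

Lemma qcomp_id i z : grQ i z -> qcomp i z = z.
Proof. by move=> /grQP[f [m [hf ->]]]; rewrite qcompE (rcomp_id hI). Qed.

Lemma qcomp_ne0 i j z : grQ i z -> i != j -> qcomp j z = 0.
Proof.
move=> /grQP[f [m [hf ->]]] ne; rewrite qcompE (rcomp_ne0 hI hf) ?fx0l //.
by apply: contra ne => /eqP/addIr->.
Qed.

Lemma qcomp_iota i x : qcomp i (iota x) = iota (rcomp i x).
Proof. by rewrite -fx0 qcompE addr0. Qed.

Lemma qcompM i j z w : grQ i z -> qcomp (i + j) (z * w) = z * qcomp j w.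
Proof.
move=> /grQP[f [m [hf ->]]]; have [g [p ->]] := fx_surj w.
rewrite fxM !qcompE fxM; congr (fx _ _).
rewrite -(rcompM hI _ _ hf); congr (rcomp _ _).
by rewrite PoszD; ring.
Qed.

Lemma qcomp_sum z : exists N m, z = \sum_(d < N) qcomp (d%:Z - m%:Z) z.
Proof.
have [f [m ->]] := fx_surj z; have [N hN] := rcomp_sum hI f.
exists N, m; rewrite {1}hN fxE rmorph_sum mulr_suml.
by apply: eq_bigr => d _; rewrite qcompE subrK fxE.
Qed.

Lemma grQ_iotaE i x : grQ i (iota x) -> gr i x.
Proof.
move=> h; have := qcomp_id h; rewrite qcomp_iota => /iota_inj <-.
exact: gr_rcomp.
Qed.

Lemma gr_iota_large : exists D : nat, forall i z, D%:Z <= i -> grQ i z ->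
  exists2 f, gr i f & z = iota f.
Proof.
have [D hD] := x0X_onto hI hx0; exists D => -[i|//] z le.
move=> /grQP[f [m [hf ->]]].
have [y hy ->] := hD i m le f hf; exists y => //.
by have := fx_shift m y 0; rewrite addn0 => ->.
Qed.

(** For [M] beyond both bounds R_M is the whole degree M piece of Q^h(R), and the unit x_0^(i-M)
    carries it to degree i. *)
Lemma grQ_has_dim : exists N, (forall i, has_dim kQ (grQ i) [set 0] N) /\
  exists D : nat, forall d, (D <= d)%N -> has_dim kR (gr d%:Z) [set 0] N.
Proof.
have [D [N hN]] := gr_dim_const hI sat hx0; have [D' hD'] := gr_iota_large.
exists N; split; last by exists D.
move=> i; pose M := maxn D D'; have le : (D <= M)%N := leq_maxl _ _.
apply: (has_dim_image (f := fun x => xq (i - M%:Z) * iota x) _ _ _ _ _ (hN M le)).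
- exact: subspace_gr.
- move=> c u v _ _; rewrite rmorphD rmorphM mulrDr mulrCA; congr (_ + _).
- move=> v Mv; rewrite -[X in grQ X](subrK M%:Z); apply: grQM.
    exact: grQ_xq.
  exact: grQ_iota.
- move=> w iw; have [| |v hv e] := hD' M%:Z (xq (M%:Z - i) * w).
  + by rewrite lez_nat leq_maxr.
  + by rewrite -[X in grQ X](subrK i); apply: grQM => //; exact: grQ_xq.
  by exists v => //; rewrite -e -opprB xqK.
- move=> v _; split=> /= [->|e0]; first by rewrite rmorph0 mulr0.
  apply: iota_inj; rewrite rmorph0 -[LHS](xqK (i - M%:Z)).
  by rewrite e0 mulr0.
Qed.

Lemma grQ0M a b : grQ 0 a -> grQ 0 b -> grQ 0 (a * b).
Proof. by move=> ha hb; rewrite -[0]addr0; exact: grQM. Qed.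

Lemma grQ0X a m : grQ 0 a -> grQ 0 (a ^+ m).
Proof.
move=> ha; elim: m => [|m IH]; first exact: grQ_one.
by rewrite exprS; exact: grQ0M.
Qed.

Lemma subspace_principal a : subspace kQ [set a * b | b in grQ 0].
Proof.
have [g0 gD] := subspace_grQ 0.
split; first by exists 0; rewrite ?mulr0.
move=> c _ _ [x hx <-] [y hy <-]; exists (kQ c * x + y); first exact: gD.
by rewrite mulrDr mulrCA.
Qed.

Lemma principal_sub a : grQ 0 a -> [set a * b | b in grQ 0] `<=` grQ 0.
Proof. by move=> ha _ [b hb <-]; exact: grQ0M. Qed.

Lemma principal_has_dim a : grQ 0 a ->
  exists d, has_dim kQ [set a * b | b in grQ 0] [set 0] d.
Proof.
move=> ha; have [N [hN _]] := grQ_has_dim.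
exact: has_dim_sub (subspace0 _) (principal_sub ha) (hN 0).
Qed.

(** The ideals a^i A decrease and are finite dimensional, so the chain is stationary from one of
    least dimension on. *)
Lemma fitting a : grQ 0 a -> exists N b, grQ 0 b /\ a ^+ N = a ^+ N.+1 * b.
Proof.
move=> ha; pose V i := [set a ^+ i * b | b in grQ 0].
have dV i : exists d, has_dim kQ (V i) [set 0] d.
  by apply: principal_has_dim; exact: grQ0X.
have ex : exists d, `[< exists i, has_dim kQ (V i) [set 0] d >].
  by have [d hd] := dV 0%N; exists d; apply/asboolP; exists 0%N.
case: (ex_minnP ex) => d /asboolP[i hi] mind.
have [d' hd'] := dV i.+1.
have sub : V i.+1 `<=` V i.
  move=> _ [b hb <-]; exists (a * b); first exact: grQ0M.
  by rewrite exprSr mulrA.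
have s0 := subspace0 kQ; have sV := subspace_principal (a ^+ i.+1).
have sub0 : [set 0] `<=` V i.+1 by move=> _ ->; case: sV.
have eqd : d' = d.
  apply/eqP; rewrite eqn_leq (has_dim_leq s0 sub hd' hi).
  by apply: mind; apply/asboolP; exists i.+1.
rewrite eqd in hd'; have eqV := has_dim_eq s0 sV sub0 sub hd' hi.
have [|b hb e] := eqV (a ^+ i).
  by exists 1; [exact: grQ_one|rewrite mulr1].
by exists i, b.
Qed.

End HomogeneousLocalization.

(** * The local rings *)

Section LocalizationMap.
Variables (K : fieldType) (n : nat) (I : idealr {mpoly K[n.+1]}).
Variable p : prime_idealr {mpoly K[n.+1]}.
Local Notation pi := (@pihomog n.+1 K mdeg).
Local Notation R := (coord_ring I).
Local Notation cls := (@cls K n I).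
Local Notation gr := (@grR K n I).
Local Notation hc := (@hcompl K n I p).
Local Notation x0 := (x0 I).
Local Notation Q := (Qh I).
Local Notation L := (locp I p).
Local Notation iota := (@Defs.iota K n I).
Local Notation kQ := (@kQ K n I).
Local Notation kL := (@kL K n I p).
Local Notation grQ := (@grQ K n I).
Local Notation frac := (@Defs.frac _ hc).

Let S1 : 1 \in hc. Proof. exact: rpred1. Qed.

Lemma kL_is_zmod_morphism : zmod_morphism kL.
Proof. by move=> x y; rewrite /Defs.kL fracN fracD // !mulr1 rmorphB. Qed.
HB.instance Definition _ :=
  GRing.isZmodMorphism.Build K L kL kL_is_zmod_morphism.

Lemma kL_is_monoid_morphism : monoid_morphism kL.
Proof.
by split=> [|x y]; rewrite /Defs.kL ?rmorph1 ?frac1 // fracM // mulr1 rmorphM.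
Qed.
HB.instance Definition _ :=
  GRing.isMonoidMorphism.Build K L kL kL_is_monoid_morphism.

Hypothesis hI : homogeneous I.
Hypothesis sat : saturated I.
Hypothesis hx0 : forall p, Defs.point I p -> 'X_ord0 \notin p.
Hypothesis hp : Defs.point I p.

Local Notation fx := (fx (I := I)).

Lemma hcomplP g : g \in hc -> exists d f,
  [/\ f \is d.-homog for mdeg, f \notin p & g = cls f].
Proof. by move=> /asboolP. Qed.

Lemma hcompl_cls f : cls f \in hc -> f \notin p.
Proof.
case/hcomplP=> d [g [gd gp /cls_eq fg]]; have [_ sIp _] := hp.
apply: contra gp => fp; rewrite -[g](subKr f) rpredB // sIp //.
Qed.

Lemma hcompl_neq0 g : g \in hc -> g != 0.
Proof.
by move=> /[dup] gS; apply: contraTneq => g0; move: gS;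
  rewrite g0 -(rmorph0 cls) => /hcompl_cls; rewrite rpred0.
Qed.

Lemma hcompl_gr d g : g \in hc -> gr d g -> exists e f,
  [/\ d = e%:Z, f \is e.-homog for mdeg, f \notin p & g = cls f].
Proof.
move=> gS gd; have g0 := hcompl_neq0 gS.
case: d gd => [d [f fd e]|d /eqP]; last by rewrite (negbTE g0).
by exists d, f; split=> //; apply: hcompl_cls; rewrite -e.
Qed.

Lemma hcompl_x0X m : x0 ^+ m \in hc.
Proof.
apply: rpredX; apply/asboolP; exists 1%N, 'X_ord0; split=> //.
  exact: dhomog_var.
exact: hx0.
Qed.

Let SX := hcompl_x0X.

Definition fl (f : R) (m : nat) : L := frac f (x0 ^+ m).

(** The canonical map from Q^h(R) to the homogeneous localization at [p], which exists because x_0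
    is invertible there. On degree 0 it is the projection of A onto the local ring at [p]. *)
Definition loc_map (z : Q) : L :=
  let s := cid (fx_surj hI sat hx0 z) in
  fl (projT1 s) (projT1 (cid (projT2 s))).

Lemma loc_mapE f m : loc_map (fx f m) = fl f m.
Proof.
rewrite /loc_map; case: (cid (fx_surj _ _ _ _)) => g /= hg.
case: cid => q /= /(fx_eq hI sat hx0) e; apply/frac_eqP => //; exists 1 => //.
by rewrite e subrr mulr0.
Qed.

Lemma flD f g m : fl f m + fl g m = fl (f + g) m.
Proof.
by rewrite /fl fracD //; apply/frac_eqP; rewrite ?rpredM //; exists 1 => //; ring.
Qed.

Lemma flN f m : - fl f m = fl (- f) m.
Proof. exact: fracN. Qed.

Lemma flM f g m q : fl f m * fl g q = fl (f * g) (m + q).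
Proof. by rewrite /fl fracM // exprD. Qed.

Lemma loc_map_is_zmod_morphism : zmod_morphism loc_map.
Proof.
move=> z w.
have [[f [m ->]] [g [q ->]]] := (fx_surj hI sat hx0 z, fx_surj hI sat hx0 w).
rewrite -(fx_shift hI sat hx0 q f) -(fx_shift hI sat hx0 m g q) [(m + q)%N]addnC.
by rewrite fxN (fxD hI sat hx0) !loc_mapE -flD flN.
Qed.
HB.instance Definition _ :=
  GRing.isZmodMorphism.Build Q L loc_map loc_map_is_zmod_morphism.

Lemma loc_map_iota x : loc_map (iota x) = frac x 1.
Proof. by rewrite -fx0 loc_mapE. Qed.

Lemma loc_map_is_monoid_morphism : monoid_morphism loc_map.
Proof.
split=> [|z w]; first by rewrite -(rmorph1 iota) loc_map_iota frac1.
have [[f [m ->]] [g [q ->]]] := (fx_surj hI sat hx0 z, fx_surj hI sat hx0 w).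
by rewrite (fxM hI sat hx0) !loc_mapE flM.
Qed.
HB.instance Definition _ :=
  GRing.isMonoidMorphism.Build Q L loc_map loc_map_is_monoid_morphism.

Lemma loc_mapD z w : loc_map (z + w) = loc_map z + loc_map w.
Proof. exact: rmorphD. Qed.

Lemma loc_mapM z w : loc_map (z * w) = loc_map z * loc_map w.
Proof. exact: rmorphM. Qed.

Lemma loc_map_kQ c : loc_map (kQ c) = kL c.
Proof. exact: loc_map_iota. Qed.

Lemma loc_map_lin c u v : loc_map (kQ c * u + v) = kL c * loc_map u + loc_map v.
Proof. by rewrite loc_mapD loc_mapM loc_map_kQ. Qed.

Lemma loc_map_Op a : grQ 0 a -> Op (loc_map a).
Proof.
move=> /(grQP hI sat hx0)[f [m [hf ->]]]; rewrite loc_mapE.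
exists m%:Z, m%:Z, f, (x0 ^+ m); split=> //; rewrite ?subrr //.
exact: gr_x0X.
Qed.

Lemma loc_map_fx_eq0 f m : loc_map (fx f m) = 0 -> exists2 w, w \in hc & w * f = 0.
Proof.
rewrite loc_mapE -(frac0 hc) => /(frac_eqP _ _ (SX m) S1)[w wS].
by rewrite mulr1 mul0r subr0; exists w.
Qed.

(* As [1 - z] is a unit of the local ring. *)
Lemma max_ideal_reg (z w : L) : max_ideal z -> z * w = w -> w = 0.
Proof.
move=> [d [f [g [fp fd gd gS ->]]]]; have [u [t [tS ->]]] := frac_repr w.
rewrite fracM // => /frac_eqP[||v vS e]; rewrite ?rpredM //.
have [e' [g' [dE g'd g'p gE]]] := hcompl_gr gS gd.
have [hom_p _ _] := hp.
(* The polynomial [f] has a homogeneous class but need not be homogeneous itself. Its component of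
   the degree of [g'] has the same class and stays in [p], so [g' - f'] is a form outside [p]. *)
pose f' := pi e' f; have f'p : f' \in p by exact: hom_p.
have ff' : cls f = cls f'.
  by rewrite dE in fd; rewrite -(rcomp_id hI fd) (rcompE hI).
have hS : cls (g' - f') \in hc.
  apply/asboolP; exists e', (g' - f'); split=> //.
    by rewrite rpredB // pihomogP.
  by rewrite rpredBr.
rewrite -(frac0 hc); apply/frac_eqP => //.
exists (v * t * cls (g' - f')); first by rewrite !rpredM.
rewrite mulr1 mul0r subr0 clsB -gE -ff'.
by rewrite -[RHS]oppr0 -e; ring.
Qed.

Lemma OpM (x y : L) : Op x -> Op y -> Op (x * y).
Proof.
move=> hx hy; have [_ _ h] := @OpP_closed K n I p.
by apply/asboolP; apply: h; apply/asboolP.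
Qed.

Lemma max_ideal_sub (z : L) : max_ideal z -> Op z.
Proof.
move=> [d [f [g [_ fd gd gS ->]]]]; exists d, d, (cls f), g.
by split=> //; rewrite subrr.
Qed.

Lemma max_idealM (z b : L) : max_ideal z -> Op b -> max_ideal (z * b).
Proof.
move=> [d [f [g [fp fd gd gS ->]]]] [d' [e' [h [l [hd ld lS de' ->]]]]].
have [h' hE] := cls_surj h.
have d'E : d' = e' by apply/eqP; rewrite -subr_eq0 -de'.
exists (d + d'), (f * h'), (g * l); split.
- by rewrite mulrC idealMr.
- by rewrite clsM -hE; exact: grRM.
- by rewrite d'E; exact: grRM.
- by rewrite rpredM.
- by rewrite fracM // clsM -hE.
Qed.

Lemma loc_map_max f m : f \is m.-homog for mdeg -> f \in p ->
  max_ideal (loc_map (fx (cls f) m)).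
Proof.
move=> fm fp; rewrite loc_mapE; exists m%:Z, f, (x0 ^+ m); split=> //.
  by exists f.
exact: gr_x0X.
Qed.

Lemma loc_map_unit g m : g \in hc -> exists w, loc_map (fx g m) * w = 1.
Proof.
move=> gS; exists (frac (x0 ^+ m) g); rewrite loc_mapE fracM //.
rewrite -(frac1 hc); apply/frac_eqP; rewrite ?rpredM //; exists 1 => //.
by ring.
Qed.

(** With a^N = a^(N+1) b from Fitting, cancelling the unit germ of a^N leaves germ(a) germ(b) = 1.
    The inverse of the germ thus comes from A. *)
Lemma loc_map_unit_inv a w : grQ 0 a -> loc_map a * w = 1 ->
  exists2 b, grQ 0 b & loc_map a * loc_map b = 1.
Proof.
move=> ha aw; have [N [b [hb aN]]] := fitting hI sat hx0 ha; exists b => //.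
have aNw : loc_map (a ^+ N) * w ^+ N = 1.
  rewrite rmorphXn /= -exprMn_comm; last exact: mulrC.
  by rewrite aw expr1n.
rewrite -[LHS]mul1r -aNw; transitivity (loc_map (a ^+ N.+1 * b) * w ^+ N).
  by rewrite exprS !loc_mapM; ring.
by rewrite -aN.
Qed.

(** Numerator and denominator have equal degree m; dividing both by x_0^m gives elements of A, and
    the denominator, whose germ is a unit, is inverted by an element of A. *)
Lemma loc_map_onto (z : L) : Op z -> exists2 a, grQ 0 a & loc_map a = z.
Proof.
move=> [d [e [f [g [fd ge gS de ->]]]]].
have dE : d = e by apply/eqP; rewrite -subr_eq0 -de.
have [m [_ [eE _ _ _]]] := hcompl_gr gS ge; rewrite dE eE in fd ge.
have gA : grQ 0 (fx g m) by apply: (grQ_fx hI sat hx0); rewrite add0r.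
have fA : grQ 0 (fx f m) by apply: (grQ_fx hI sat hx0); rewrite add0r.
have [w gw] := loc_map_unit m gS.
have [b bA gb] := loc_map_unit_inv gA gw.
exists (fx f m * b); first by rewrite -[0]addr0; apply: (grQM hI sat hx0).
rewrite -[RHS]mulr1 -gb loc_mapM mulrA; congr (_ * _).
rewrite !loc_mapE fracM //; apply/frac_eqP; rewrite ?rpredM //.
by exists 1 => //; ring.
Qed.

Lemma has_dim_Op_ker V W (V' : set L) d : subspace kQ V ->
  (forall v, V v -> V' (loc_map v)) ->
  (forall w, V' w -> exists2 v, V v & loc_map v = w) ->
  (forall v, V v -> W v <-> loc_map v = 0) ->
  has_dim kQ V W d <-> has_dim kL V' [set 0] d.
Proof.
move=> sV hV hs hW; split.
  apply: (has_dim_image sV _ hV hs hW) => c u v _ _; exact: loc_map_lin.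
apply: (has_dim_preimage sV _ hV hs hW) => c u v _ _; exact: loc_map_lin.
Qed.

Lemma subspace_loc_map_ker : subspace kQ [set a | loc_map a = 0].
Proof.
split=> [|c u v /= hu hv]; first exact: rmorph0.
by rewrite loc_map_lin hu hv mulr0 addr0.
Qed.

Lemma subspace_Op : subspace kL (@Op K n I p).
Proof.
have [_ h] := subspace_grQ hI sat hx0 0.
split=> [|c u v /loc_map_onto[a ha <-] /loc_map_onto[b hb <-]].
  by rewrite -(rmorph0 loc_map); apply: loc_map_Op; case: (subspace_grQ hI sat hx0 0).
by rewrite -loc_map_lin; apply: loc_map_Op; exact: h.
Qed.

Lemma Op_has_dim : exists d, has_dim kL (@Op K n I p) [set 0] d.
Proof.
have [N [hN _]] := grQ_has_dim hI sat hx0; have [e [_ _ se]] := hN 0.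
have [|d hd] := has_dim_spanned (V := grQ 0) (g := e) subspace_loc_map_ker.
  move=> v /se[c ec]; exists c; rewrite /lincomb.
  by move: ec => /= ->; rewrite rmorph0.
have kerP v : grQ 0 v -> [set a | loc_map a = 0] v <-> loc_map v = 0 by [].
exists d; have sQ := subspace_grQ hI sat hx0 0.
exact: (has_dim_Op_ker d sQ loc_map_Op loc_map_onto kerP).1 hd.
Qed.

End LocalizationMap.

(** * The degree 0 part as the product of the local rings *)

Section Points.
Variables (K : fieldType) (n : nat) (I : idealr {mpoly K[n.+1]}).
Variables (s : nat) (pt : 'I_s -> prime_idealr {mpoly K[n.+1]}).
Local Notation P := {mpoly K[n.+1]}.
Local Notation pi := (@pihomog n.+1 K mdeg).
Local Notation cls := (@cls K n I).
Local Notation x0 := (x0 I).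
Local Notation Q := (Qh I).
Local Notation kQ := (@kQ K n I).
Local Notation grQ := (@grQ K n I).
Local Notation fx := (fx (I := I)).

Hypothesis hI : homogeneous I.
Hypothesis sat : saturated I.
Hypothesis zdim : zero_dimensional I.
Hypothesis hpt : enum_supp I pt.
Hypothesis hX : forall j, 'X_ord0 \notin pt j.

Lemma x0_notin_point p : Defs.point I p -> 'X_ord0 \notin p.
Proof. by case: hpt => _ _ h /h[j ->]. Qed.

Local Notation hx0 := x0_notin_point.

Lemma ptP j : Defs.point I (pt j).
Proof. by case: hpt. Qed.

Definition germ_map j : Q -> locp I (pt j) := loc_map (pt j) hI sat hx0.

Lemma germ_mapD j z w : germ_map j (z + w) = germ_map j z + germ_map j w.
Proof. exact: loc_mapD (ptP j) z w. Qed.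

Lemma germ_mapM j z w : germ_map j (z * w) = germ_map j z * germ_map j w.
Proof. exact: loc_mapM (ptP j) z w. Qed.

Lemma germ_map1 j : germ_map j 1 = 1.
Proof. by have [] := loc_map_is_monoid_morphism hI sat hx0 (ptP j). Qed.

Lemma germ_map0 j : germ_map j 0 = 0.
Proof. by apply: addr_idem0; rewrite -germ_mapD addr0. Qed.

Lemma germ_mapX j z m : germ_map j (z ^+ m) = germ_map j z ^+ m.
Proof. by elim: m => [|m IH]; rewrite ?germ_map1 // !exprS germ_mapM IH. Qed.

Lemma germ_map_fx j f m : germ_map j (fx f m) = germ (pt j) m f.
Proof. exact: loc_mapE (ptP j) f m. Qed.

(** It suffices that a power of x_0 kills the numerator [x]. Otherwise some homogeneous prime
    contains the annihilator of [x] and avoids X_0; it is one of the points, yet at each point an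
    element outside the prime kills [x]. *)
Lemma germ_map_inj i z : grQ i z -> (forall j, germ_map j z = 0) -> z = 0.
Proof.
move=> /(grQP hI sat hx0)[x [m [xd ->]]] zero.
have /choice[w hw] j : exists w, w \in hcompl (pt j) /\ w * x = 0.
  by have [w wS wx] := loc_map_fx_eq0 (ptP j) (zero j); exists w.
suff [N xN] : exists N, x0 ^+ N * x = 0.
  by rewrite (x0X_reg hI sat hx0 xN); exact: (fx0l hI sat hx0).
apply: contrapT => no; pose J := [set h : P | x * cls h = 0].
have [|||||q [hq Jq nq]] := @homogeneous_prime_avoidance _ _ J 'X_ord0 1%N.
- by rewrite /J /= rmorph0 mulr0.
- move=> a u v /= hu hv; rewrite /J /= rmorphD rmorphM mulrDr mulrCA.
  by rewrite hu hv mulr0 addr0.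
- move=> h d /= xh; have := rcompM hI d%:Z (cls h) xd.
  by rewrite xh (rcomp0 hI) (rcompE hI).
- exact: dhomog_var.
- by move=> N /= h; apply: no; exists N; rewrite mulrC -rmorphXn.
have [j qj] : exists j, q =i pt j.
  case: hpt => _ _; apply; split=> //; last by exists ord0.
  by move=> f /cls_eq0 fI; apply: Jq; rewrite /J /= fI mulr0.
have [wS wx] := hw j; have [d [h [_ hp e]]] := hcomplP wS.
by case/negP: hp; rewrite -qj; apply: Jq; rewrite /J /= -e mulrC.
Qed.

(** Dimension zero excludes inclusions between distinct points, and some homogeneous component of a
    separating polynomial still separates. *)
Lemma points_separated j k : j != k ->
  exists d f, [/\ f \is d.-homog for mdeg, f \in pt j & f \notin pt k].
Proof.
move=> ne; have [f fj fk] : exists2 f, f \in pt j & f \notin pt k.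
  apply: contrapT => no; case/eqP: ne.
  have [_ inj _] := hpt; apply: inj; case: zdim => _; apply.
  - exact: ptP.
  - exact: ptP.
  - by move=> f fj; apply: contrapT => /negP fk; apply: no; exists f.
have [d fd] : exists d, pi d f \notin pt k.
  apply: contrapT => no; case/negP: fk.
  rewrite (pihomog_sum (leqnn (msize f))) rpred_sum // => d _.
  by apply: contrapT => /negP fd; apply: no; exists (val d).
exists d, (pi d f); split=> //; first exact: pihomogP.
by have [hom _ _] := ptP j; exact: hom.
Qed.

(* By Fitting, a power of [c = a b] is stable under multiplication by [c], which
   has germ 1 where [a] is a unit and lies in the maximal ideal where [a] does. *)
Lemma separating_element j k : j != k ->
  exists2 e, grQ 0 e & germ_map k e = 1 /\ germ_map j e = 0.
Proof.
move=> /points_separated[d [f [fd fj fk]]].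
have aA : grQ 0 (fx (cls f) d).
  by apply: (grQ_fx hI sat hx0); rewrite add0r; exists f.
have [N [b [hb aN]]] := fitting hI sat hx0 aA; pose c := fx (cls f) d * b.
have cA : grQ 0 c by exact: (grQ0M hI sat hx0).
have cN : c * c ^+ N = c ^+ N.
  by rewrite /c exprMn_comm; [rewrite [in RHS]aN exprS; ring|exact: mulrC].
have [w aw] : exists w, germ_map k (fx (cls f) d) * w = 1.
  apply: (loc_map_unit hI sat hx0 (ptP k)).
  by apply/asboolP; exists d, f.
have ck : germ_map k c = 1.
  have awN : germ_map k (fx (cls f) d) ^+ N * w ^+ N = 1.
    by rewrite -exprMn_comm ?aw ?expr1n //; exact: mulrC.
  rewrite -[LHS]mulr1 -awN -germ_mapX.
  rewrite mulrA -germ_mapM; congr (germ_map k _ * _).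
  by rewrite /c {2}aN exprS; ring.
exists (c ^+ N); first exact: (grQ0X hI sat hx0).
split; first by rewrite germ_mapX ck expr1n.
apply: (@max_ideal_reg _ _ _ _ hI (ptP j) (germ_map j c)).
  rewrite germ_mapM; apply: max_idealM; last exact: loc_map_Op (ptP j) _ hb.
  exact: (loc_map_max hI sat hx0 (ptP j)).
by rewrite -germ_mapM cN.
Qed.

Lemma idempotent_at k : exists2 e, grQ 0 e &
  germ_map k e = 1 /\ forall j, j != k -> germ_map j e = 0.
Proof.
have /choice[e he] j : exists e, j != k ->
    [/\ grQ 0 e, germ_map k e = 1 & germ_map j e = 0].
  have [->|/separating_element[e eA [ek ej]]] := eqVneq j k; first by exists 0.
  by exists e.
exists (\prod_(j | j != k) e j).
  apply: big_ind => [|x y|j /he[]//]; first exact: (grQ_one hI sat hx0).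
  exact: (grQ0M hI sat hx0).
split=> [|j ne].
  apply: (big_ind (fun z => germ_map k z = 1)) => [|x y hx hy|j /he[]//].
    exact: germ_map1.
  by rewrite germ_mapM hx hy mulr1.
by rewrite (bigD1 j) //= germ_mapM; have [_ _ ->] := he j ne; rewrite mul0r.
Qed.

Lemma subspace_vanishing (T : pred 'I_s) :
  subspace kQ [set a | grQ 0 a /\ forall k, T k -> germ_map k a = 0].
Proof.
have [g0 gD] := subspace_grQ hI sat hx0 0.
split=> [|c u v [hu zu] [hv zv]].
  by split=> // k _; rewrite germ_map0.
split=> [|k Tk]; first exact: gD.
by rewrite germ_mapD germ_mapM zu // zv // mulr0 addr0.
Qed.

(** The count follows the flag [V m] of elements with zero germ at all points of index at least [m].
    The elements from [idempotent_at] make each successive quotient the local ring at one point, and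
    injectivity of germs makes [V 0] zero. *)
Lemma grQ0_has_dim : has_dim kQ (grQ 0) [set 0] (degX I pt).
Proof.
pose V m := [set a | grQ 0 a /\ forall k : 'I_s, (m <= k)%N -> germ_map k a = 0].
pose d k := dimK (@kL _ _ I (pt k)) (@Op _ _ I (pt k)) [set 0].
have sV m : subspace kQ (V m) := subspace_vanishing (fun k => m <= k)%N.
have dO k : has_dim (@kL _ _ I (pt k)) (@Op _ _ I (pt k)) [set 0] (d k).
  have [e he] := Op_has_dim hI sat hx0 (ptP k).
  by rewrite /d (dimK_eq (subspace0 _) he).
have step (k : 'I_s) : has_dim kQ (V k.+1) (V k) (d k).
  have hV v : V k.+1 v -> Op (germ_map k v).
    by move=> [hv _]; exact: (loc_map_Op _ _ _ (ptP k)).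
  have hs w : Op w -> exists2 v, V k.+1 v & germ_map k v = w.
    move=> /(loc_map_onto hI sat hx0 (ptP k))[a ha aw].
    have [e eA [ek ej]] := idempotent_at k.
    exists (a * e); last by rewrite germ_mapM ek mulr1.
    split; first exact: (grQ0M hI sat hx0).
    move=> j kj; rewrite germ_mapM ej ?mulr0 //.
    by rewrite -val_eqE /= neq_ltn kj orbT.
  have hW v : V k.+1 v -> V k v <-> germ_map k v = 0.
    move=> [hv zv]; split=> [[_ h]|h]; first exact: h.
    split=> // j; rewrite leq_eqVlt => /predU1P[e|lt]; last exact: zv.
    by have <- : k = j by exact: val_inj.
  exact: (has_dim_Op_ker (ptP k) (d k) (sV k.+1) hV hs hW).2 (dO k).
have hV m : (m <= s)%N -> has_dim kQ (V m) [set 0] (\sum_(k < s | (k < m)%N) d k).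
  elim: m => [|m IH] lem.
    rewrite big1 //; have -> : V 0%N = [set 0]; last exact/has_dim0/subspace0.
    apply/seteqP; split=> [a [ha za]|_ ->].
      by apply: (germ_map_inj ha) => j; exact: za.
    split=> [|k _]; last exact: germ_map0.
    by case: (subspace_grQ hI sat hx0 0).
  rewrite (bigD1 (Ordinal lem)) //= addnC.
  rewrite (eq_bigl (fun k : 'I_s => (k < m)%N)); last first.
    move=> k; rewrite -val_eqE /= ltnS andbC.
    by case: ltngtP.
  apply: (has_dim_add (subspace0 _) (sV m)).
  - by move=> _ ->; case: (sV m).
  - by move=> a [ha za]; split=> // k lt; apply: za; exact: ltnW.
  - exact: IH (ltnW lem).
  - exact: step (Ordinal lem).
have -> : grQ 0 = V s.
  apply/seteqP; split=> [a ha|a []//]; split=> // k le.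
  by have := ltn_ord k; rewrite ltnNge le.
have -> : degX I pt = \sum_(k < s | (k < s)%N) d k.
  by apply: eq_bigl => k; rewrite ltn_ord.
exact: hV.
Qed.

End Points.

(** * The subscheme defined by a socle element *)

Lemma nmin_le (N : set nat) i : N i -> (nmin N <= i)%N.
Proof.
move=> Ni; have ex : exists m, `[< N m >] by exists i; apply/asboolP.
case: (ex_minnP ex) => m /asboolP Nm minm; rewrite /nmin.
case: xgetP => [_ -> [_]|/(_ m)[]]; first exact.
by split=> // j Nj; apply: minm; apply/asboolP.
Qed.

Section SocleSubscheme.
Variables (K : fieldType) (n : nat) (I : idealr {mpoly K[n.+1]}).
Variables (s : nat) (pt : 'I_s -> prime_idealr {mpoly K[n.+1]}).
Local Notation P := {mpoly K[n.+1]}.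
Local Notation R := (coord_ring I).
Local Notation cls := (@cls K n I).
Local Notation gr := (@grR K n I).
Local Notation x0 := (x0 I).
Local Notation Q := (Qh I).
Local Notation iota := (@Defs.iota K n I).
Local Notation grQ := (@grQ K n I).
Local Notation fx := (fx (I := I)).
Local Notation xq := (xq I).
Local Notation frac := (@Defs.frac _).

Hypothesis hI : homogeneous I.
Hypothesis sat : saturated I.
Hypothesis zdim : zero_dimensional I.
Hypothesis hpt : enum_supp I pt.
Hypothesis hX : forall j, 'X_ord0 \notin pt j.

Local Notation hx0 := (x0_notin_point hpt hX).
Local Notation germ_map := (germ_map hI sat hpt hX).
Local Notation ptP := (ptP hpt).

Variables (k : 'I_s) (a : Q).
Hypothesis aA : grQ 0 a.
Hypothesis ak : germ_map k a <> 0.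
Hypothesis aj : forall j, j != k -> germ_map j a = 0.
Hypothesis asoc : forall z : locp I (pt k), max_ideal z -> z * germ_map k a = 0.

(** The contraction to P of the principal ideal a Q^h(R). It defines the subscheme whose local ring
    at [pt k] is the quotient by the germ of [a], the other local rings being unchanged. *)
Definition socle_ideal : {pred P} :=
  fun f => `[< exists q, iota (cls f) = a * q >].

Lemma socle_idealP f : reflect (exists q, iota (cls f) = a * q) (f \in socle_ideal).
Proof. exact: asboolP. Qed.

Lemma socle_ideal_subscheme :
  [/\ ideal socle_ideal, homogeneous socle_ideal & saturated socle_ideal].
Proof.
split.
- split; first by apply/socle_idealP; exists 0; rewrite !rmorph0 mulr0.
  move=> b f g /socle_idealP[q hq] /socle_idealP[q' hq']; apply/socle_idealP.
  exists (iota (cls b) * q + q').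
  by rewrite !rmorphD !rmorphM /= hq hq' mulrDr; congr (_ + _); exact: mulrCA.
- move=> f d /socle_idealP[q hq]; apply/socle_idealP.
  exists (qcomp hI sat hx0 d q); rewrite -(qcompM hI sat hx0 _ _ aA) add0r -hq.
  by rewrite (qcomp_iota hI sat hx0) (rcompE hI).
(* Saturation is tested on the single form X_0^N, whose class is a unit of Q^h(R). *)
- move=> f [N hN]; apply/socle_idealP.
  have /hN/socle_idealP[q] : ('X_ord0 ^+ N : P) \is N.-homog for mdeg.
    by rewrite -[X in X.-homog]mul1n; apply: dhomogMn; exact: dhomog_var.
  rewrite rmorphM rmorphM /= rmorphXn => hq; exists (xq (- N%:Z) * q).
  by rewrite mulrCA -hq; have := xqK hI sat hx0 N%:Z (iota (cls f)) => /= ->.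
Qed.

Lemma sub_socle_ideal : {subset I <= socle_ideal}.
Proof.
by move=> f /cls_eq0 fI; apply/socle_idealP; exists 0; rewrite fI rmorph0 mulr0.
Qed.

Lemma ext_socle_ideal l (z : locp I (pt l)) : ext socle_ideal z ->
  exists2 b, Op b & b * germ_map l a = z.
Proof.
move=> [d [f [g [/socle_idealP[q hq] fd gd gS ->]]]].
have [e [_ [dE _ _ _]]] := hcompl_gr (ptP l) gS gd; rewrite dE in fd gd.
(* The cofactor [q] need not be homogeneous; as [a] has degree 0, its component of degree e is
   enough. *)
pose b := xq (- e%:Z) * qcomp hI sat hx0 e%:Z q.
have bA : grQ 0 b.
  rewrite -[0](addNr e%:Z); apply: (grQM hI sat hx0); first exact: (grQ_xq hI sat hx0).
  exact: (grQ_qcomp hI sat hx0).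
have fE : fx (cls f) e = a * b.
  rewrite (fxE hI sat hx0) mulrC /b mulrCA -(qcompM hI sat hx0 _ _ aA) add0r -hq.
  by rewrite (qcomp_id hI) //; exact: (grQ_iota hI sat hx0).
have eS := hcompl_x0X hx0 (ptP l) e.
pose u := frac (hcompl (pt l)) (x0 ^+ e) g.
have uO : Op u by exists e%:Z, e%:Z, (x0 ^+ e), g; split=> //; rewrite ?subrr //; exact: gr_x0X.
exists (germ_map l b * u).
  by apply: OpM => //; exact: (loc_map_Op hI sat hx0 (ptP l)).
rewrite mulrAC [X in X * _]mulrC -germ_mapM -fE germ_map_fx.
rewrite /germ fracM //; apply/frac_eqP; rewrite ?rpredM //.
by exists 1; [exact: rpred1|ring].
Qed.

Lemma socle_ideal_ext (b : locp I (pt k)) : Op b -> ext socle_ideal (b * germ_map k a).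
Proof.
move=> /(loc_map_onto hI sat hx0 (ptP k))[c cA <-].
rewrite -/(germ_map k c) -germ_mapM mulrC.
have /(grQP hI sat hx0)[f [m [fm acE]]] := grQ0M hI sat hx0 aA cA.
rewrite add0r in fm; have [f' fE] := cls_surj f.
exists m%:Z, f', (x0 ^+ m); split.
- apply/socle_idealP; exists (c * xq m%:Z).
  rewrite mulrA acE (fxE hI sat hx0) -mulrA -(xqD hI sat hx0) addNr.
  by rewrite (xq0 I) mulr1 fE.
- by rewrite -fE.
- exact: gr_x0X.
- exact: (hcompl_x0X hx0 (ptP k)).
- by rewrite acE germ_map_fx fE.
Qed.

Lemma socle_ideal_extE : ext socle_ideal = [set b * germ_map k a | b in @Op _ _ I (pt k)].
Proof.
apply/seteqP; split=> [z /ext_socle_ideal[b hb <-]|_ [b hb <-]].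
  by exists b.
exact: socle_ideal_ext.
Qed.

Lemma ext_socle_ideal0 l : l != k -> @ext _ _ I (pt l) socle_ideal = [set 0].
Proof.
move=> /aj al; apply/seteqP; split=> [z /ext_socle_ideal[b _ <-]|_ ->].
  by rewrite al mulr0.
exists 0, 0, 1; split.
- by apply/socle_idealP; exists 0; rewrite cls0 rmorph0 mulr0.
- by rewrite cls0; exact: gr0.
- exact: grR1.
- exact: rpred1.
- by rewrite cls0 frac0.
Qed.

(** An element outside the maximal ideal is a unit and cannot kill the nonzero germ of [a].
    Multiplication by this germ therefore identifies the residue field with the socle ideal, which
    yields the degree drop by [varkappa]. *)
Lemma max_ideal_socle (b : locp I (pt k)) : Op b -> max_ideal b <-> b * germ_map k a = 0.
Proof.
move=> bO; split=> [/asoc//|b0]; case: bO b0 => d [e [f [g [fd ge gS de ->]]]] b0.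
have dE : d = e by apply/eqP; rewrite -subr_eq0 -de.
rewrite -dE in ge; have [m [_ [dm _ _ _]]] := hcompl_gr (ptP k) gS ge.
rewrite dm in fd ge; case: fd => f' f'm fE.
have [f'p|f'p] := boolP (f' \in pt k).
  by exists m%:Z, f', g; rewrite -fE; split=> //; exists f'.
have fS : f \in hcompl (pt k) by apply/asboolP; exists m, f'.
have gf : frac (hcompl (pt k)) g f * frac (hcompl (pt k)) f g = 1.
  rewrite fracM // -(frac1 (hcompl (pt k))); apply/frac_eqP.
  - exact: rpredM.
  - exact: rpred1.
  by exists 1; [exact: rpred1|ring].
by case: ak; rewrite -[LHS]mul1r -gf -mulrA b0 mulr0.
Qed.

Let kL := @kL _ _ I (pt k).
Let O := @Op _ _ I (pt k).

Lemma subspace_socle : subspace kL (ext socle_ideal).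
Proof.
have [O0 OD] := subspace_Op hI sat hx0 (ptP k).
rewrite socle_ideal_extE; split; first by exists 0; rewrite ?mul0r.
move=> c _ _ [x hx <-] [y hy <-]; exists (kL c * x + y); first exact: OD.
by rewrite mulrDl mulrA.
Qed.

Lemma ext_socle_sub : ext socle_ideal `<=` O.
Proof.
move=> _ /ext_socle_ideal[b bO <-].
by apply: OpM => //; exact: (loc_map_Op hI sat hx0 (ptP k)).
Qed.

Lemma residue_has_dim : exists d, has_dim kL O (@max_ideal _ _ I (pt k)) d /\
  has_dim kL (ext socle_ideal) [set 0] d.
Proof.
have [N hN] := Op_has_dim hI sat hx0 (ptP k).
have [d hd] := has_dim_sub (subspace0 _) ext_socle_sub hN.
exists d; split=> //; apply: (has_dim_preimage (f := fun b => b * germ_map k a) _ _ _ _ _ hd).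
- exact: (subspace_Op hI sat hx0 (ptP k)).
- by move=> c u v _ _; rewrite mulrDl mulrA.
- by move=> v; exact: socle_ideal_ext.
- by move=> w /ext_socle_ideal.
- exact: max_ideal_socle.
Qed.

Lemma maximal_socle_subscheme : maximal_subscheme I pt k socle_ideal.
Proof.
split.
- exact: socle_ideal_subscheme.
- exact: sub_socle_ideal.
- by move=> l lk; rewrite ext_socle_ideal0 //; exact: subset_refl.
have [d [dmax dsoc]] := residue_has_dim.
have [N hN] := Op_has_dim hI sat hx0 (ptP k); have [e [_ _ se]] := hN.
have sE := subspace_socle; have sE0 : [set 0] `<=` @ext _ _ I (pt k) socle_ideal.
  by move=> _ ->; case: sE.
have [|d' hd'] := has_dim_spanned (V := O) (g := e) sE.
  by move=> v /se[c hc]; exists c; apply: sE0.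
have sO := subspace_Op hI sat hx0 (ptP k).
have hsum := has_dim_add (subspace0 _) sE sE0 ext_socle_sub dsoc hd'.
have smax : subspace kL (@max_ideal _ _ I (pt k)).
  have [O0 OD] := sO; split=> [|c u v hu hv].
    by apply/(max_ideal_socle O0); rewrite mul0r.
  apply/max_ideal_socle; first by apply: OD; exact: max_ideal_sub.
  by rewrite mulrDl -mulrA (asoc hu) (asoc hv) mulr0 addr0.
rewrite /deg_sub /degX /varkappa (bigD1 k) //= [in RHS](bigD1 k) //=.
rewrite (dimK_eq sE hd') (dimK_eq smax dmax) (dimK_eq (subspace0 _) hsum).
rewrite addnAC [(d' + d)%N]addnC; congr (_ + _)%N.
by apply: eq_bigr => l /ext_socle_ideal0 ->.
Qed.

(** As [deg_point] and [mu] are minima, one subscheme and one basis of the residue field give an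
    upper bound. By hypothesis each product e_i s_k is the germ of an element of R_m whose other
    germs vanish. *)
Lemma deg_point_socle m :
  (forall b, grQ 0 b -> exists2 f, gr m%:Z f & a * b = fx f m) ->
  (deg_point I pt k <= m)%N.
Proof.
move=> hF; have [d [[e he] _]] := residue_has_dim.
have [eO _ _] := he.
pose M := (\max_(i < d) mu (e i * germ_map k a)%R)%N.
have hM : (M <= m)%N.
  apply/bigmax_leqP => i _; apply: nmin_le.
  have [c cA ce] := loc_map_onto hI sat hx0 (ptP k) (eO i).
  have [f fm acE] := hF c cA; exists f; split=> //.
    by rewrite -(germ_map_fx hI sat hpt hX) -acE germ_mapM mulrC /germ_map ce.
  by move=> l lk; rewrite -(germ_map_fx hI sat hpt hX) -acE germ_mapM aj // mul0r.
apply: leq_trans hM; apply: nmin_le; exists socle_ideal.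
  exact: maximal_socle_subscheme.
exists (germ_map k a), d, e; split=> //; last exact: socle_ideal_extE.
split=> //; exact: (loc_map_Op hI sat hx0 (ptP k) aA).
Qed.

End SocleSubscheme.

(** * The filtration and the Cayley-Bacharach property *)

Section RegularityIndex.
Variables (H : int -> nat) (N : nat).
Hypothesis stable : exists D : nat, forall d : nat, (D <= d)%N -> H d%:Z = N.

Lemma hilbert_poly_const p : hilbert_poly H p -> p = N%:R%:P.
Proof.
move=> [M hM]; have [D hD] := stable; apply/eqP; rewrite -subr_eq0; apply/eqP.
set q := p - _; pose E := maxn D `|M|%N.
have rootq (j : nat) : (E <= j)%N -> q.[j%:R] = 0.
  move=> le; have lj : M <= j%:Z.
    rewrite (le_trans (ler_norm M)) // -abszE lez_nat.
    by rewrite (leq_trans _ le) // leq_maxr.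
  have := hM j%:Z lj; rewrite hD ?(leq_trans _ le) ?leq_maxl // => e.
  by rewrite /q hornerD hornerN hornerC e -pmulrn subrr.
apply/eqP; apply: contraT => q0.
(* These are [size q] distinct roots, one more than a nonzero [q] can have. *)
pose rs := [seq (i%:R : rat) | i <- seq.iota E (size q)].
have : (size rs < size q)%N.
  apply: max_poly_roots => //.
    apply/allP => x /mapP[i]; rewrite mem_iota => /andP[le _] ->.
    by apply/eqP; exact: rootq.
  rewrite map_inj_uniq ?iota_uniq // => i j /eqP; rewrite eqr_nat.
  by move/eqP.
by rewrite size_map size_iota ltnn.
Qed.

Lemma is_ri_const r : is_ri H r <->
  (forall j, r <= j -> H j = N) /\ (forall i, (forall j, i <= j -> H j = N) -> r <= i).
Proof.
have horner_const j : ((H j)%:R == (N%:R%:P : {poly rat}).[j%:~R]) = (H j == N).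
  by rewrite hornerC eqr_nat.
split=> [[p /hilbert_poly_const -> [h1 h2]]|[h1 h2]].
  split=> [j /h1/eqP|i hi]; first by rewrite horner_const => /eqP.
  by apply: h2 => j /hi/eqP; rewrite -horner_const => /eqP.
exists N%:R%:P.
  by exists r => j /h1/eqP; rewrite -horner_const => /eqP.
split=> [j /h1/eqP|i hi]; first by rewrite -horner_const => /eqP.
by apply: h2 => j /hi/eqP; rewrite horner_const => /eqP.
Qed.

(** The condition at -1 keeps the stable range within the nonnegative degrees, so the least natural
    number found is also least among the integers. *)
Lemma is_ri_ri : H (-1) <> N -> is_ri H (ri H).
Proof.
move=> neg; rewrite /ri; apply: (xgetPex 0).
have ex : exists d : nat, `[< forall j : nat, (d <= j)%N -> H j%:Z = N >].
  by have [D hD] := stable; exists D; apply/asboolP.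
case: (ex_minnP ex) => d /asboolP hd mind; exists d%:Z; apply/is_ri_const.
split=> [[j|j] // le|[i|i] hi]; first exact: hd.
  by apply: mind; apply/asboolP => j le; exact: hi.
by case: neg; apply: hi; rewrite NegzE lerN2 lez_nat.
Qed.

Lemma is_ri_pred r : is_ri H r -> H (r - 1) <> N.
Proof.
move=> /is_ri_const[h1 h2] e; suff : r <= r - 1 by rewrite lerDl.
apply: h2 => j; rewrite le_eqVlt => /predU1P[<-//|].
by rewrite -lezD1 subrK => /h1.
Qed.

End RegularityIndex.

(** * The filtration of the degree 0 part by the pieces of R *)

Section DedekindDifferent.
Variables (K : fieldType) (n : nat) (I : idealr {mpoly K[n.+1]}).
Variables (s : nat) (pt : 'I_s -> prime_idealr {mpoly K[n.+1]}).
Local Notation kR := (@kR K n I).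
Local Notation gr := (@grR K n I).
Local Notation x0 := (x0 I).
Local Notation Q := (Qh I).
Local Notation iota := (@Defs.iota K n I).
Local Notation kQ := (@kQ K n I).
Local Notation grQ := (@grQ K n I).
Local Notation fx := (fx (I := I)).
Local Notation xq := (xq I).

Hypothesis hI : homogeneous I.
Hypothesis sat : saturated I.
Hypothesis zdim : zero_dimensional I.
Hypothesis hpt : enum_supp I pt.
Hypothesis hX : forall j, 'X_ord0 \notin pt j.

Local Notation hx0 := (x0_notin_point hpt hX).
Local Notation germ_map := (germ_map hI sat hpt hX).
Local Notation germ_map_inj := (@germ_map_inj _ _ _ _ _ hI sat hpt hX _ _).
Local Notation ptP := (ptP hpt).
Local Notation xqD := (xqD hI sat hx0).
Local Notation xqK := (xqK hI sat hx0).
Local Notation xqVK := (xqVK hI sat hx0).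
Local Notation grQM := (grQM hI sat hx0).
Local Notation grQ0M := (grQ0M hI sat hx0).
Local Notation grQ_xq := (grQ_xq hI sat hx0).
Local Notation grQ_iota := (grQ_iota hI sat hx0).
Local Notation iota_inj := (@iota_inj _ _ _ hI sat hx0).
Local Notation N := (degX I pt).

Lemma grQ_degree i z : grQ i z -> exists2 a, grQ 0 a & z = xq i * a.
Proof.
move=> hz; exists (xq (- i) * z); last by rewrite xqVK.
by rewrite -[X in grQ X](addNr i); apply: grQM => //; exact: grQ_xq.
Qed.

Lemma grQ_xqM i a : grQ 0 a -> grQ i (xq i * a).
Proof. by move=> ha; rewrite -[i in grQ i]addr0; apply: grQM => //; exact: grQ_xq. Qed.

(* The subspace F_i of the header. *)
Definition Fil (i : int) : set Q := [set a | exists2 f, gr i f & iota f = xq i * a].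

Lemma Fil_iota i f : gr i f -> Fil i (xq (- i) * iota f).
Proof. by move=> hf; exists f => //; rewrite xqVK. Qed.

Lemma Fil_sub i : Fil i `<=` grQ 0.
Proof.
move=> a [f hf e]; have := grQ_iota hf; rewrite e => h.
rewrite -[a](xqK i) -[X in grQ X](addNr i); apply: grQM => //; exact: grQ_xq.
Qed.

Lemma Fil0 i : Fil i 0.
Proof. by exists 0; [exact: gr0|rewrite rmorph0 mulr0]. Qed.

Lemma subspace_Fil i : subspace kQ (Fil i).
Proof.
split=> [|c u v [f hf fu] [g hg gv]]; first exact: Fil0.
exists (kR c * f + g).
  by have [_ h] := subspace_gr I i; exact: h.
by rewrite rmorphD rmorphM /= fu gv mulrDr [X in _ = X + _]mulrCA.
Qed.

Lemma Fil_neg i a : i < 0 -> Fil i a -> a = 0.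
Proof.
case: i => // i _ [f -> e]; rewrite -[a](xqK (Negz i)) -e.
by rewrite rmorph0 mulr0.
Qed.

Lemma Fil_le i j : i <= j -> Fil i `<=` Fil j.
Proof.
move=> le a [f hf e]; have [m jE] : exists m : nat, j = i + m%:Z.
  by exists `|j - i|%N; rewrite gez0_abs ?subr_ge0 // [RHS]addrC subrK.
exists (x0 ^+ m * f).
  by rewrite jE addrC; apply: grRM => //; exact: gr_x0X.
by rewrite rmorphM /= e jE xqD -!mulrA mulrCA; congr (_ * _).
Qed.

Lemma Fil_fx (m : nat) a : Fil m%:Z a -> exists2 f, gr m%:Z f & a = fx f m.
Proof.
move=> [f hf e]; exists f => //.
by rewrite (fxE hI sat hx0) mulrC e xqK.
Qed.

Lemma has_dim_Fil i d : has_dim kR (gr i) [set 0] d <-> has_dim kQ (Fil i) [set 0] d.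
Proof.
have flin c u v : gr i u -> gr i v ->
    xq (- i) * iota (kR c * u + v) = kQ c * (xq (- i) * iota u) + xq (- i) * iota v.
  by move=> _ _; rewrite rmorphD rmorphM /= mulrDr; congr (_ + _); exact: mulrCA.
have fV v : gr i v -> Fil i (xq (- i) * iota v) by exact: Fil_iota.
have fsurj w : Fil i w -> exists2 v, gr i v & xq (- i) * iota v = w.
  by move=> [f hf e]; exists f => //; rewrite e xqK.
have fW v : gr i v -> [set 0] v <-> [set 0] (xq (- i) * iota v).
  move=> _; split=> /= [->|e]; first by rewrite rmorph0 mulr0.
  by apply: iota_inj; rewrite -[LHS](xqVK i) e mulr0 rmorph0.
split.
  exact: has_dim_image (subspace_gr I i) flin fV fsurj fW _.
exact: has_dim_preimage (subspace_gr I i) flin fV fsurj fW _.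
Qed.

Lemma HFX_has_dim i : has_dim kR (gr i) [set 0] (HFX I i).
Proof.
have [d hd] := coord_has_dim I i; rewrite /HFX /HF setTI.
by rewrite (dimK_eq (subspace0 _) hd).
Qed.

Lemma degX_unique d : has_dim kQ (grQ 0) [set 0] d -> d = N.
Proof.
by move=> h; apply: has_dim_uniq h (grQ0_has_dim hI sat zdim hpt hX); exact: subspace0.
Qed.

Lemma grQ_has_degX i : has_dim kQ (grQ i) [set 0] N.
Proof. by have [d [hd _]] := grQ_has_dim hI sat hx0; rewrite -(degX_unique (hd 0)). Qed.

Lemma HFX_stable : exists D : nat, forall d : nat, (D <= d)%N -> HFX I d%:Z = N.
Proof.
have [d [hd [D hD]]] := grQ_has_dim hI sat hx0; exists D => e le.
rewrite -(degX_unique (hd 0)).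
exact: has_dim_uniq (subspace0 _) (HFX_has_dim _) (hD e le).
Qed.

Lemma degX_gt0 : (0 < N)%N.
Proof.
rewrite lt0n; apply/eqP => N0; have := grQ_has_degX 0; rewrite N0.
move=> /has_dim_sub0/(_ _ (grQ_one hI sat hx0)) /=.
rewrite -(rmorph1 iota) -(rmorph0 iota) => /iota_inj/eqP.
by rewrite (negbTE (coord_neq0 I)).
Qed.

(** [ri] has a default value when there is no regularity index. The function is stable in large
    degree and its value at -1 is 0, which differs from deg X > 0, so the default is not taken. *)
Lemma rX_is_ri : is_ri (HFX I) (rX I).
Proof.
apply: (is_ri_ri HFX_stable).
have -> : HFX I (-1) = 0%N.
  apply: has_dim_uniq (subspace0 kR) (HFX_has_dim _) _.
  exact: has_dim0 (subspace0 _).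
by move=> N0; have := degX_gt0; rewrite -N0.
Qed.

Local Notation r := (rX I).

Lemma Fil_full i : r <= i -> grQ 0 `<=` Fil i.
Proof.
move=> le; have /(is_ri_const HFX_stable)[h _] := rX_is_ri.
have hd := HFX_has_dim i; rewrite (h i le) in hd.
apply: (has_dim_eq (subspace0 _) (subspace_Fil i) _ (@Fil_sub i) _ (grQ_has_degX 0)).
  by move=> _ ->; exact: Fil0.
exact/has_dim_Fil.
Qed.

Lemma Fil_not_full : exists2 x, grQ 0 x & ~ Fil (r - 1) x.
Proof.
apply: contrapT => no; apply: (is_ri_pred HFX_stable rX_is_ri).
have eqF : Fil (r - 1) = grQ 0.
  apply/seteqP; split=> [|x hx]; first exact: Fil_sub.
  by apply: contrapT => nx; apply: no; exists x.
apply: has_dim_uniq (subspace0 _) (HFX_has_dim _) _.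
by apply/has_dim_Fil; rewrite eqF; exact: grQ_has_degX.
Qed.

Lemma iota_ge i z : r <= i -> grQ i z -> range iota z.
Proof.
by move=> le /grQ_degree[a /(Fil_full le)[f hf e] ->]; exists f.
Qed.

Lemma range_iota_Fil i a : grQ 0 a -> range iota (xq i * a) -> Fil i a.
Proof.
move=> aA [f _ e]; exists f => //; apply: (grQ_iotaE hI sat hx0).
by rewrite e; exact: grQ_xqM.
Qed.

Hypothesis CB : cayley_bacharach I pt.

(** X has a point, and the Cayley-Bacharach condition at that point makes r_X a natural number. *)
Lemma rX_deg_point : exists r0 : nat, r = r0%:Z /\ forall j, deg_point I pt j = r0.
Proof.
have [[p pP] _] := zdim; have [_ _ /(_ p pP)[j0 _]] := hpt.
have const (f : 'I_s -> nat) (c : int) : (forall j, (f j)%:Z = c) ->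
    exists m : nat, c = m%:Z /\ forall j, f j = m.
  move=> fc; exists (f j0); split; first by rewrite fc.
  by move=> j; apply/eqP; rewrite -eqz_nat !fc.
exact: (const _ _ CB).
Qed.

(* A nonzero ideal of A contained in Fil (r - 1) would contain a minimal one,
   generated by a socle element at some point p_j, and the subscheme it defines
   would show deg_X(p_j) <= r - 1. *)
Lemma ideal_in_Fil a : grQ 0 a -> (forall b, grQ 0 b -> Fil (r - 1) (a * b)) -> a = 0.
Proof.
move=> aA aF; apply: contrapT => a0.
have [r0 [rE degE]] := rX_deg_point.
(* For r_X = 0 the piece F_(-1) is zero and already contains [a]. Otherwise r_X - 1 is natural,
   hence a possible value of [mu]. *)
case: r0 rE degE => [|r0] rE degE.
  apply: a0; apply: (@Fil_neg (r - 1)); first by rewrite rE.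
  by rewrite -[a]mulr1; apply: aF; exact: (grQ_one hI sat hx0).
have r1 : r - 1 = r0%:Z by rewrite rE -addn1 PoszD addrK.
have [k ak] : exists k, germ_map k a <> 0.
  apply: contrapT => no; apply: a0; apply: (germ_map_inj aA) => j.
  by apply: contrapT => aj; apply: no; exists j.
have [e eA [ek ej]] := idempotent_at hI sat zdim hpt hX k.
(* Multiplying by [e] kills the germs away from p_k. A multiple of [a1] generating a nonzero ideal
   of least dimension is then chosen. *)
pose a1 := a * e; have a1A : grQ 0 a1 by exact: grQ0M.
pose I1 b := [set b * c | c in grQ 0].
have ex : exists d, `[< exists c, [/\ grQ 0 c, a1 * c <> 0 &
    has_dim kQ (I1 (a1 * c)) [set 0] d] >].
  have [d hd] := principal_has_dim hI sat hx0 a1A; exists d; apply/asboolP.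
  exists 1; rewrite mulr1; split; [exact: (grQ_one hI sat hx0)| |exact: hd].
  move=> z; apply: ak; move: (congr1 (germ_map k) z).
  by rewrite germ_mapM ek mulr1 germ_map0.
case: (ex_minnP ex) => d /asboolP[c [cA nz hd]] mind.
pose a2 := a1 * c; have a2A : grQ 0 a2 by exact: grQ0M.
have a2j j : j != k -> germ_map j a2 = 0.
  by move=> jk; rewrite /a2 /a1 !germ_mapM ej // mulr0 mul0r.
have a2k : germ_map k a2 <> 0.
  move=> z; apply: nz; apply: (germ_map_inj a2A) => j.
  by case: (eqVneq j k) => [->|/a2j]; [exact: z|exact].
(* If z a2 were nonzero, minimality of the dimension would give z a2 A = a2 A, hence a2 = z u a2 at
   p_k with z u in the maximal ideal; then the germ of a2 would vanish. *)
have soc (z : locp I (pt k)) : max_ideal z -> z * germ_map k a2 = 0.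
  move=> zm; have [b bA zE] := loc_map_onto hI sat hx0 (ptP k) (max_ideal_sub zm).
  apply: contrapT => nzz.
  have nzb : a1 * (c * b) <> 0.
    move=> z0; apply: nzz; rewrite -zE -/(germ_map k b) -germ_mapM mulrC.
    by rewrite /a2 -mulrA z0 germ_map0.
  have cbA : grQ 0 (c * b) by exact: grQ0M.
  have [d' hd'] := principal_has_dim hI sat hx0 (grQ0M a1A cbA).
  have sub : I1 (a1 * (c * b)) `<=` I1 a2.
    move=> _ [u uA <-]; exists (b * u); first exact: grQ0M.
    by rewrite /a2 !mulrA.
  have s0 := subspace0 kQ.
  have dd : d' = d.
    apply/eqP; rewrite eqn_leq (has_dim_leq s0 sub hd' hd).
    by apply: mind; apply/asboolP; exists (c * b).
  rewrite dd in hd'; have sI := subspace_principal hI sat hx0 (a1 * (c * b)).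
  have sub0 : [set 0] `<=` I1 (a1 * (c * b)) by move=> _ ->; case: sI.
  have a2I : I1 a2 a2 by exists 1; [exact: (grQ_one hI sat hx0)|rewrite mulr1].
  have [u uA ue] := has_dim_eq s0 sI sub0 sub hd' hd a2I.
  apply: a2k; apply: (max_ideal_reg hI (ptP k) (z := z * germ_map k u)).
    by apply: max_idealM => //; exact: (loc_map_Op hI sat hx0 (ptP k)).
  rewrite -zE -/(germ_map k b) -!germ_mapM; congr (germ_map k _).
  by rewrite -[RHS]ue /a2 mulrC !mulrA.
have hm b : grQ 0 b -> exists2 f, gr r0%:Z f & a2 * b = fx f r0.
  move=> bA; apply: Fil_fx; rewrite -r1.
  have -> : a2 * b = a * (e * c * b) by rewrite /a2 /a1 !mulrA.
  by apply: aF; apply: grQ0M => //; exact: grQ0M.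
by have := deg_point_socle a2A a2k a2j soc hm; rewrite degE ltnn.
Qed.

End DedekindDifferent.

(** * The trace form and the Dedekind different *)

Section TraceMap.
Variables (K : fieldType) (n : nat) (I : idealr {mpoly K[n.+1]}).
Variables (s : nat) (pt : 'I_s -> prime_idealr {mpoly K[n.+1]}).
Local Notation gr := (@grR K n I).
Local Notation iota := (@Defs.iota K n I).
Local Notation kR := (@kR K n I).
Local Notation x0 := (x0 I).
Local Notation Q := (Qh I).
Local Notation kQ := (@kQ K n I).
Local Notation grQ := (@grQ K n I).
Local Notation fx := (fx (I := I)).
Local Notation xq := (xq I).

Hypothesis hI : homogeneous I.
Hypothesis sat : saturated I.
Hypothesis zdim : zero_dimensional I.
Hypothesis hpt : enum_supp I pt.
Hypothesis hX : forall j, 'X_ord0 \notin pt j.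

Local Notation hx0 := (x0_notin_point hpt hX).
Local Notation qcomp := (qcomp hI sat hx0).
Local Notation xqD := (xqD hI sat hx0).
Local Notation xqK := (xqK hI sat hx0).
Local Notation xqVK := (xqVK hI sat hx0).
Local Notation grQM := (grQM hI sat hx0).
Local Notation grQ_xq := (grQ_xq hI sat hx0).
Local Notation grQ_iota := (grQ_iota hI sat hx0).
Local Notation grQ_xqM := (grQ_xqM hI sat hpt hX).
Local Notation grQ0M := (grQ0M hI sat hx0).
Local Notation iota_inj := (@iota_inj _ _ _ hI sat hx0).
Local Notation subspace_grQ := (subspace_grQ hI sat hx0).
Local Notation N := (degX I pt).
Local Notation Fil := (@Fil K n I).
Local Notation r := (rX I).
Local Notation grQ_degree := (grQ_degree hI sat hpt hX).
Local Notation Fil_sub := (Fil_sub hI sat hpt hX).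

Variable sigma : Q -> Q.
Hypothesis tr : trace_map sigma.

Lemma L0_xq i : L0 (xq i).
Proof.
case: i => m.
  by exists 'X^m, 0%N; rewrite map_polyXn hornerXn.
by exists 1, m.+1; rewrite rmorph1 hornerC.
Qed.

Lemma L0_kQ c : L0 (kQ c).
Proof. by exists c%:P, 0%N; rewrite map_polyC hornerC. Qed.

Lemma horner_kR (q : {poly K}) :
  (map_poly kR q).[x0] = \sum_(i < size q) kR q`_i * x0 ^+ i.
Proof. by rewrite /map_poly horner_poly. Qed.

(** The component of degree m of q(x_0) is its m-th term, so dividing by x_0^m leaves a constant. *)
Lemma L0_deg0 z : L0 z -> grQ 0 z -> exists c, z = kQ c.
Proof.
move=> [q [m zE]] z0; exists q`_m.
rewrite -(qcomp_id hI sat hx0 z0) zE -/(fx _ m) (qcompE hI sat hx0) add0r.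
have -> : rcomp m%:Z (map_poly kR q).[x0] = kR q`_m * x0 ^+ m.
  have [lt|le] := ltnP m (size q); last first.
    rewrite nth_default // rmorph0 mul0r horner_kR (rcomp_sumE hI) big1 // => i _.
    rewrite (rcompZ hI) (rcomp_ne0 hI (gr_x0X I i)) ?mulr0 //.
    by rewrite eqz_nat neq_ltn (leq_trans (ltn_ord i) le).
  rewrite horner_kR (rcomp_sumE hI) (bigD1 (Ordinal lt)) //= big1 ?addr0.
    by rewrite (rcompZ hI) (rcomp_id hI) //; exact: gr_x0X.
  move=> i ne; rewrite (rcompZ hI) (rcomp_ne0 hI (gr_x0X I i)) ?mulr0 //.
by rewrite (fxE hI sat hx0) rmorphM /= -mulrA -[_ * xq _](xqD m%:Z) subrr (xq0 I) mulr1.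
Qed.

Lemma sigmaD x y : sigma (x + y) = sigma x + sigma y.
Proof. by case: tr => [[[_ h _] _] _]; exact: h. Qed.

Lemma sigmaZ b x : L0 b -> sigma (b * x) = b * sigma x.
Proof. by case: tr => [[[_ _ h] _] _]; exact: h. Qed.

Lemma sigma0 : sigma 0 = 0.
Proof. by apply: addr_idem0; rewrite -sigmaD addr0. Qed.

Lemma sigma_sum (T : Type) (l : seq T) (F : T -> Q) :
  sigma (\sum_(j <- l) F j) = \sum_(j <- l) sigma (F j).
Proof. by apply: big_morph; [exact: sigmaD|exact: sigma0]. Qed.

Lemma sigma_grQ i x : grQ i x -> grQ i (sigma x).
Proof. by case: tr => [[_ h] _] /h; rewrite addr0. Qed.

Lemma sigma_xqM i x : sigma (xq i * x) = xq i * sigma x.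
Proof. by rewrite sigmaZ //; exact: L0_xq. Qed.

Lemma sigma_qcomp i z : qcomp i (sigma z) = sigma (qcomp i z).
Proof.
have [M [m zE]] := qcomp_sum hI sat hx0 z.
rewrite {1}zE {2}zE sigma_sum !(qcomp_sumE hI sat hx0) sigma_sum.
apply: eq_bigr => d _; set y := qcomp _ z.
have yd : grQ (d%:Z - m%:Z) y by exact: (grQ_qcomp hI sat hx0).
have [<-|ne] := eqVneq (d%:Z - m%:Z) i.
  by rewrite !(qcomp_id hI sat hx0) //; exact: sigma_grQ.
by rewrite !(qcomp_ne0 hI sat hx0 _ ne) ?sigma0 //; exact: sigma_grQ.
Qed.

Lemma kQ_inj : injective kQ.
Proof. by move=> c d /iota_inj; exact: fmorph_inj. Qed.

(** The K-valued trace on A: sigma preserves degree, and L_0 has only constants in degree 0. The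
    trace form is tau (a * b). *)
Definition tau (z : Q) : K := xget 0 [set c | sigma z = kQ c].

Lemma tauE z : grQ 0 z -> sigma z = kQ (tau z).
Proof.
move=> hz; rewrite /tau; case: xgetP => [c _ //|no].
have [|c cE] := L0_deg0 _ (sigma_grQ hz); last by case: (no c).
by case: tr => [[[h _ _] _] _]; exact: h.
Qed.

(** Linearity over powers of x_0 extends the vanishing from A to all of Q^h(R). Then a sigma = 0 = 0
    sigma, and the coefficient of the basis element sigma is unique. *)
Lemma sigma_nondegenerate a : grQ 0 a ->
  (forall b, grQ 0 b -> sigma (a * b) = 0) -> a = 0.
Proof.
move=> aA az; have sz z : sigma (a * z) = 0.
  have [M [m ->]] := qcomp_sum hI sat hx0 z; rewrite mulr_sumr sigma_sum big1 // => d _.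
  have [b bA ->] := grQ_degree (grQ_qcomp hI sat hx0 (d%:Z - m%:Z) z).
  by rewrite mulrCA sigma_xqM az // mulr0.
have zero_hom : graded_hom (@L0 K n I) grQ (fun=> 0).
  exists 0%N, (fun=> 0), (fun _ _ => 0); split; first by case.
  by move=> x; rewrite big_ord0.
have [_ /(_ _ zero_hom)[g [_ gu]]] := tr.
by rewrite -(gu a) ?(gu 0) // => x; rewrite ?sz // mul0r sigma0.
Qed.

(** The orthogonal of F_(r-1). The index r - 1 is -i - 1 for i = -r, the lowest degree in which the
    complementary module can be nonzero. *)
Definition perp : set Q :=
  [set b | grQ 0 b /\ forall f, Fil (r - 1) f -> sigma (b * f) = 0].

Lemma perp_separates x : grQ 0 x -> ~ Fil (r - 1) x ->
  exists2 y, perp y & sigma (y * x) <> 0.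
Proof.
move=> xA nx; have gD := (subspace_grQ 0).2.
have linr y c u v : grQ 0 y -> grQ 0 u -> grQ 0 v ->
    tau (y * (kQ c * u + v)) = c * tau (y * u) + tau (y * v).
  move=> hy hu hv; have huv := gD c u v hu hv; apply: kQ_inj.
  rewrite rmorphD rmorphM /= -(tauE (grQ0M hy huv)) -(tauE (grQ0M hy hu)).
  rewrite -(tauE (grQ0M hy hv)) mulrDr sigmaD mulrCA.
  by rewrite (sigmaZ _ (L0_kQ c)).
have linl y c u v : grQ 0 y -> grQ 0 u -> grQ 0 v ->
    tau ((kQ c * u + v) * y) = c * tau (u * y) + tau (v * y).
  by move=> hy hu hv; rewrite !(mulrC _ y) linr.
have nd a : grQ 0 a -> (forall y, grQ 0 y -> tau (y * a) = 0) -> a = 0.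
  move=> aA az; apply: (sigma_nondegenerate aA) => b bA.
  by rewrite mulrC tauE ?az ?rmorph0 //; exact: grQ0M.
have [y [yA yF yx]] := form_separates (subspace_grQ 0)
  (grQ_has_degX hI sat zdim hpt hX 0) linr linl nd
  (subspace_Fil I (r - 1)) (@Fil_sub (r - 1)) xA nx.
exists y.
  split=> // f Ff; rewrite tauE ?yF ?rmorph0 //; apply: grQ0M => //.
  exact: (Fil_sub Ff).
rewrite tauE; last exact: grQ0M.
by move=> e; apply: yx; apply: kQ_inj; rewrite e rmorph0.
Qed.

(** * Elements of lowest degree in the complementary module *)

Section ComplementaryModule.
Variable b : Q.
Hypothesis bp : perp b.
Let g := xq (- r) * b.

(** Writing f = x_0^d a with a in F_d gives sigma (g f) = x_0^(d-r) tau (b a). A negative exponent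
    never survives: for d < r the element a lies in F_(r-1), to which b is orthogonal. *)
Lemma perp_hom_gr d f : gr d f ->
  exists y, [/\ iota y = sigma (g * iota f), Kx0 y & gr (d - r) y].
Proof.
move=> fd; have [bA bF] := bp.
have fF := Fil_iota hI sat hpt hX fd; set a := xq (- d) * iota f in fF.
have aA := Fil_sub fF.
have sE : sigma (g * iota f) = xq (d - r) * sigma (b * a).
  rewrite -sigma_xqM; congr (sigma _).
  by rewrite -[iota f in LHS](xqVK d) mulrACA -xqD [- r + d]addrC.
rewrite sE; case: (leP r d) => [le|lt].
  have [m mE] : exists m : nat, d - r = m%:Z.
    by exists `|d - r|%N; rewrite gez0_abs // subr_ge0.
  rewrite mE tauE; last exact: grQ0M.
  exists (kR (tau (b * a)) * x0 ^+ m); split.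
  - by rewrite rmorphM /= mulrC.
  - exists ((tau (b * a)) *: 'X^m).
    by rewrite linearZ /= map_polyXn hornerZ hornerXn.
  - by rewrite -[X in gr X]add0r; apply: grRM; [exact: gr_kR|exact: gr_x0X].
have Fa : Fil (r - 1) a.
  by apply: (Fil_le hI sat hpt hX _ fF); rewrite lerBrDr -ltzD1 ltrD2r.
exists 0; rewrite bF // mulr0 rmorph0; split=> //.
  by exists 0; rewrite rmorph0 horner0.
exact: gr0.
Qed.

Lemma Kx0D : forall x y, @Kx0 K n I x -> Kx0 y -> Kx0 (x + y).
Proof. by move=> _ _ [p ->] [q ->]; exists (p + q); rewrite rmorphD hornerD. Qed.

Lemma perp_hom f : exists y, iota y = sigma (g * iota f) /\ Kx0 y.
Proof.
have [M ->] := rcomp_sum hI f; rewrite rmorph_sum mulr_sumr sigma_sum.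
elim: M => [|M [y [yE yK]]].
  exists 0; rewrite big_ord0 rmorph0; split=> //.
  by exists 0; rewrite rmorph0 horner0.
have [z [zE zK _]] := perp_hom_gr (gr_rcomp M%:Z f).
exists (y + z); rewrite big_ord_recr rmorphD /= yE zE; split=> //.
exact: Kx0D.
Qed.

(** The restriction of g sigma to R takes values in K[x_0] and is homogeneous of degree -r; its
    extension to L_0 is g sigma again. *)
Lemma perp_compl : compl_module sigma g.
Proof.
have /choice[phi hphi] : forall f, exists y, iota y = sigma (g * iota f) /\ Kx0 y.
  exact: perp_hom.
have phiE f : iota (phi f) = sigma (g * iota f) by case: (hphi f).
have iotaL c : Kx0 c -> L0 (iota c) by move=> [q ->]; exists q, 0%N.
exists phi => [|c f cL]; last by rewrite mulrCA sigmaZ // phiE.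
exists 1%N, (fun=> - r), (fun=> phi); split=> [_|x]; last by rewrite big_ord1.
split=> [|i x xi]; last first.
  have [y [yE _ yd]] := perp_hom_gr xi.
  by have -> : phi x = y by apply: iota_inj; rewrite yE phiE.
split=> [x|x y|c x cK].
- by case: (hphi x).
- by apply: iota_inj; rewrite rmorphD /= !phiE rmorphD mulrDr sigmaD.
- apply: iota_inj; rewrite rmorphM /= !phiE rmorphM /= mulrCA.
  by rewrite (sigmaZ _ (iotaL c cK)).
Qed.

End ComplementaryModule.

(** For f in R_r the component of degree r + k < 0 of sigma (g f), an element of R, is zero. Since
    R_r is all of x_0^r A, the component of [g] of degree k is orthogonal to everything. *)
Lemma compl_module_low g k : compl_module sigma g -> k < - r -> qcomp k g = 0.
Proof.
move=> [phi _ hphi] kr.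
have [h hA hE] := grQ_degree (grQ_qcomp hI sat hx0 k g).
suff h0 : h = 0 by rewrite hE h0 mulr0.
apply: (sigma_nondegenerate hA) => a aA.
have [f fr fE] := Fil_full hI sat zdim hpt hX (lexx r) aA.
have rk : r + k < 0 by rewrite addrC -ltrBrDr sub0r.
have e : sigma (iota f * qcomp k g) = 0.
  rewrite -(qcompM hI sat hx0 k g (grQ_iota fr)) -sigma_qcomp.
  have := hphi 1 f; rewrite mul1r mulrC => -> //; last by rewrite -(xq0 I); exact: L0_xq.
  by rewrite mul1r (qcomp_iota hI sat hx0) rcomp_neg // rmorph0.
rewrite -[LHS](xqK (r + k)) -sigma_xqM; move: e; rewrite hE fE => e.
rewrite (_ : xq (r + k) * (h * a) = xq r * a * (xq k * h)); first by rewrite e mulr0.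
by rewrite [RHS]mulrACA -xqD [h * a]mulrC.
Qed.

Lemma subspace_different : subspace kQ (different sigma).
Proof.
split=> [g _|c u v du dv g gC]; first by exists 0; rewrite // rmorph0 mul0r.
have [[y _ ye] [z _ ze]] := (du g gC, dv g gC).
by exists (kR c * y + z) => //; rewrite rmorphD rmorphM /= ye ze mulrDl mulrA.
Qed.

Lemma different_x0X m z : different sigma z -> different sigma (xq m%:Z * z).
Proof.
move=> dz g gC; have [y _ ye] := dz g gC.
by exists (x0 ^+ m * y) => //; rewrite rmorphM /= ye mulrA.
Qed.

(** The complementary module begins no lower than degree -r, so multiplying by degree at least 2 r
    lands in degree at least r, where R fills Q^h(R). *)
Lemma different_full i : 2 * r <= i -> grQ i `<=` different sigma.
Proof.
move=> le f fi g gC; have [M [m ->]] := qcomp_sum hI sat hx0 g; rewrite mulr_sumr.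
elim/big_ind: _ => [|_ _ [x _ <-] [y _ <-]|d _].
- by exists 0; rewrite // rmorph0.
- by exists (x + y); rewrite // rmorphD.
set j := d%:Z - m%:Z; have [lt|ge] := ltP j (- r).
  by rewrite (compl_module_low gC lt) mulr0; exists 0; rewrite // rmorph0.
apply: (@iota_ge _ _ _ _ pt hI sat zdim hpt hX (i + j)).
  by rewrite [leLHS](_ : _ = 2 * r + - r); [exact: lerD|ring].
by apply: grQM => //; exact: (grQ_qcomp hI sat hx0).
Qed.

Hypothesis CB : cayley_bacharach I pt.

Lemma different_low i : i < r -> different sigma `&` grQ i `<=` [set 0].
Proof.
move=> ir f [df fi]; have [a aA fE] := grQ_degree fi.
have ab b : perp b -> a * b = 0.
  move=> bp; have [bA _] := bp; have [y _ ye] := df _ (perp_compl bp).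
  have abE : f * (xq (- r) * b) = xq (i - r) * (a * b) by rewrite fE mulrACA -xqD.
  (* The product of [f] with x_0^(-r) b lies in R and has degree i - r < 0, where R vanishes. *)
  apply: (@Fil_neg _ _ _ _ _ hI sat hpt hX (i - r)); first by rewrite subr_lt0.
  apply: (range_iota_Fil hI sat hpt hX); first exact: grQ0M.
  by exists y => //; rewrite ye abE.
suff a0 : a = 0 by rewrite fE a0 mulr0.
(* If a c were outside F_(r-1), some [y] in [perp] would have sigma (y a c) nonzero, although y a =
   0. *)
apply: (ideal_in_Fil hI sat zdim hpt hX CB aA) => c cA; apply: contrapT => nF.
have [y yp] := perp_separates (grQ0M aA cA) nF; apply.
by rewrite mulrA [y * a]mulrC ab // mul0r sigma0.
Qed.

Lemma different_not_full : exists2 z, grQ (2 * r - 1) z & ~ different sigma z.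
Proof.
have [x xA nx] := Fil_not_full hI sat zdim hpt hX.
have [y yp yx] := perp_separates xA nx; have [yA _] := yp.
apply: contrapT => no; apply: yx; suff -> : y = 0 by rewrite mul0r sigma0.
apply: (ideal_in_Fil hI sat zdim hpt hX CB yA) => c cA.
apply: (range_iota_Fil hI sat hpt hX); first exact: grQ0M.
(* The degrees 2 r - 1 and -r add up to r - 1, so a full different in degree 2 r - 1 would put every
   y c into F_(r-1). *)
have -> : xq (r - 1) * (y * c) = xq (2 * r - 1) * c * (xq (- r) * y).
  rewrite [RHS]mulrACA -xqD [c * y]mulrC; congr (xq _ * _).
  by ring.
have dz : different sigma (xq (2 * r - 1) * c).
  by apply: contrapT => nd; apply: no; exists (xq (2 * r - 1) * c); first exact: grQ_xqM.
exact: dz (perp_compl yp).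
Qed.

(** * The Hilbert function of the different *)

Local Notation D i := (different sigma `&` grQ i).

Lemma subspace_differentI i : subspace kQ (D i).
Proof.
have [[d0 dD] [g0 gD]] := (subspace_different, subspace_grQ i).
by split=> // c u v [du gu] [dv gv]; split; [exact: dD|exact: gD].
Qed.

Lemma HFdiff_has_dim i : has_dim kQ (D i) [set 0] (HFdiff sigma i).
Proof.
have [d hd] := has_dim_sub (subspace0 _) (@subIsetr _ (different sigma) _)
  (grQ_has_degX hI sat zdim hpt hX i).
by rewrite /HFdiff /HF (dimK_eq (subspace0 _) hd).
Qed.

Lemma HFdiff_low i : i < r -> HFdiff sigma i = 0%N.
Proof.
move=> ir; apply: has_dim_uniq (subspace0 _) (HFdiff_has_dim i) _.
have -> : D i = [set 0]; last exact/has_dim0/subspace0.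
apply/seteqP; split; first exact: different_low.
by move=> _ ->; case: (subspace_differentI i).
Qed.

Lemma HFdiff_high i : 2 * r <= i -> HFdiff sigma i = degX I pt.
Proof.
move=> le; apply: has_dim_uniq (subspace0 _) (HFdiff_has_dim i) _.
have -> : D i = grQ i; last exact: (grQ_has_degX hI sat zdim hpt hX).
by apply/setIidPr; exact: different_full.
Qed.

(** The different is stable under x_0, and x_0 is a unit of Q^h(R), so multiplication by x_0^(j-i)
    embeds degree i into degree j. *)
Lemma HFdiff_le i j : i <= j -> (HFdiff sigma i <= HFdiff sigma j)%N.
Proof.
move=> le; have [m jE] : exists m : nat, j = m%:Z + i.
  by exists `|j - i|%N; rewrite gez0_abs ?subr_ge0 // subrK.
pose V := [set xq m%:Z * z | z in D i].
have sD := subspace_differentI i.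
have dV : has_dim kQ V [set 0] (HFdiff sigma i).
  apply: (has_dim_image (f := fun z => xq m%:Z * z) sD _ _ _ _ (HFdiff_has_dim i)).
  - by move=> c u v _ _; rewrite mulrDr mulrCA.
  - by move=> v Dv; exists v.
  - by move=> _ [v Dv <-]; exists v.
  - move=> v _; split=> /= [->|e]; first by rewrite mulr0.
    by rewrite -[v](xqK m%:Z) e mulr0.
apply: (has_dim_leq (subspace0 _) _ dV (HFdiff_has_dim j)).
move=> _ [z [dz zi] <-]; split; first exact: different_x0X.
by rewrite jE; apply: grQM => //; exact: grQ_xq.
Qed.

Lemma HFdiff_strict : (HFdiff sigma (2 * r - 1) < degX I pt)%N.
Proof.
have [z zi nz] := different_not_full.
apply: (has_dim_ltn (subspace0 _) (subspace_differentI _) _ _ zi _ (HFdiff_has_dim _)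
  (grQ_has_degX hI sat zdim hpt hX _)).
- by move=> _ ->; case: (subspace_differentI (2 * r - 1)).
- exact: subIsetr.
- by move=> [].
Qed.

Lemma HFdiff_ri : is_ri (HFdiff sigma) (2 * r).
Proof.
have stable : exists E : nat, forall d : nat, (E <= d)%N -> HFdiff sigma d%:Z = degX I pt.
  exists `|(2 * r)%R|%N => d le; apply: HFdiff_high.
  by rewrite (le_trans (ler_norm _)) // -abszE lez_nat.
apply/(is_ri_const stable); split=> [j|i hi]; first exact: HFdiff_high.
rewrite leNgt; apply/negP => lt; have := HFdiff_strict.
by rewrite hi ?ltnn // lerBrDr -ltzD1 ltrD2r.
Qed.

End TraceMap.

Theorem proposition4p8 (K : fieldType) (n : nat)
    (I : idealr {mpoly K[n.+1]}) (s : nat)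
    (pt : 'I_s -> prime_idealr {mpoly K[n.+1]}) (sigma : Qh I -> Qh I) :
  homogeneous I -> saturated I -> zero_dimensional I ->
  enum_supp I pt -> (forall j, 'X_ord0 \notin pt j) ->
  locally_gorenstein I pt -> cayley_bacharach I pt ->
  trace_map sigma ->
  let HFd : int -> nat := HFdiff sigma in
  let r : int := rX I in
  (forall i : int,
     has_dim (kQ I) (different sigma `&` grQ i) [set 0] (HFd i)) /\
  [/\ forall i : int, i < r -> HFd i = 0%N,
      forall i : int, 2 * r <= i -> HFd i = degX I pt,
      forall i j : int, r <= i -> i <= j -> j <= 2 * r - 1 ->
        (0 <= HFd i <= HFd j)%N,
      (HFd (2 * r - 1)%R < HFd (2 * r)%R)%N /\ HFd (2 * r) = degX I pt
    & is_ri HFd (2 * r)].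
Proof.
move=> hI sat zdim hpt hX _ CB tr HFd r.
have high := HFdiff_high hI sat zdim hpt hX tr.
(* [dimK] is 0 by convention in infinite dimension; this conjunct certifies that the values of [HFd]
   are actual dimensions. *)
split; first exact: (HFdiff_has_dim hI sat zdim hpt hX sigma).
split.
- exact: (HFdiff_low hI sat zdim hpt hX tr CB).
- exact: high.
- move=> i j _ le _; rewrite leq0n /=.
  exact: (HFdiff_le hI sat zdim hpt hX sigma le).
- rewrite /HFd (high (2 * r) (lexx _)); split=> //.
  exact: (HFdiff_strict hI sat zdim hpt hX tr CB).
- exact: (HFdiff_ri hI sat zdim hpt hX tr CB).
Qed.
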